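(* In an ISI channel with memory length $\nu$, transmission block length $L$, data rate $R$, and an MMSE SC-FDE receiver, the outage probability satisfies $P_{\rm out}(R,\nu,L)\doteq {\sf SNR}^{-d_{\rm out}(R,\nu,L)}$, where $$d_{\rm out}(R,\nu,L)=\begin{cases}\nu+1 & \text{for } R\le \log\frac{L}{\nu},\\ \lfloor 2^{-R}L\rfloor+1 & \text{for } R>\log\frac{L}{\nu}.\end{cases}$$
   Context: Logarithms in rates and mutual information are base 2. Here $\nu\ge 1$ and $L\ge \nu+1$ are fixed integers, $R>0$ is a fixed rate, and ${\sf SNR}>0$ is a real parameter tending to infinity. The channel coefficients $h_0,\dots,h_\nu$ are i.i.d. circularly symmetric complex Gaussian $\mathcal{CN}(0,1)$, and $\lambda_k=\sum_{i=0}^{\nu}h_i e^{-j2\pi i(k-1)/L}$ for $k=1,\dots,L$ (with $j=\sqrt{-1}$); these are the eigenvalues of the $L\times L$ circulant channel matrix $H_{\rm eq}$ with first row $(h_0,\dots,h_\nu,0,\dots,0)$. The received block is $y=\sqrt{\sf SNR}\,H_{\rm eq}x+n$, with $x$ the transmitted block of unit-average-power symbols and $n$ zero-mean complex Gaussian noise with covariance $I$. The MMSE SC-FDE receiver outputs $\tilde y=[H_{\rm eq}^HH_{\rm eq}+{\sf SNR}^{-1}I]^{-1}H_{\rm eq}^H\,y$; its unbiased decision-point SINR on every stream is $\gamma=\big[\frac1L\sum_{k=1}^L\frac{1}{1+{\sf SNR}|\lambda_k|^2}\big]^{-1}-1$, and the effective mutual information is $I(x;\tilde y)=\log(1+\gamma)=-\log\big[\frac1L\sum_{k=1}^L\frac{1}{1+{\sf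 SNR}|\lambda_k|^2}\big]$. The outage probability is $P_{\rm out}(R,\nu,L)=P[I(x;\tilde y)<R]=P\big[\frac1L\sum_{k=1}^L\frac{1}{1+{\sf SNR}|\lambda_k|^2}>2^{-R}\big]$, and $d_{\rm out}(R,\nu,L)=-\lim_{{\sf SNR}\to\infty}\frac{\log P_{\rm out}(R,\nu,L)}{\log{\sf SNR}}$. Exponential equality: $f({\sf SNR})\doteq g({\sf SNR})$ means $\lim_{{\sf SNR}\to\infty}\frac{\log f}{\log{\sf SNR}}=\lim_{{\sf SNR}\to\infty}\frac{\log g}{\log{\sf SNR}}$. *)

(* Defs.v *)
From HB Require Import structures.
From mathcomp Require Import all_boot all_order all_algebra.
From mathcomp Require Import all_classical all_reals all_analysis.
From mathcomp.real_closed Require Import complex.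
From mathcomp Require Import ring lra.
Set Implicit Arguments.
Unset Strict Implicit.
Unset Printing Implicit Defensive.
Import Order.TTheory GRing.Theory Num.Theory.
Import numFieldTopology.Exports numFieldNormedType.Exports.
Import ComplexField.Normc.
Local Open Scope classical_set_scope.
Local Open Scope ring_scope.
Local Open Scope sesquilinear_scope.

Definition log2 {R : realType} (x : R) : R := ln x / ln 2.

Section Channel.
Context {R : realType}.
Implicit Types (snr : R) (L nu : nat).

Definition expi (t : R) : R[i] := (cos t +i* sin t)%C.

Definition channel_tap nu (h : 'I_nu.+1 -> R[i]) (m : nat) : R[i] :=
  if (m < nu.+1)%N then h (inord m) else 0.

(* First row (h_0, ..., h_nu, 0, ..., 0), each row being the cyclic right shift
   of the previous one.  The summand L avoids truncation: i < L. *)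
Definition circulant_channel L nu (h : 'I_nu.+1 -> R[i]) : 'M[R[i]]_L :=
  \matrix_(i < L, j < L) channel_tap h ((j + L - i) %% L)%N.

(* k is 0-based. *)
Definition channel_eigenvalue L nu (h : 'I_nu.+1 -> R[i]) (k : 'I_L) : R[i] :=
  \sum_(i < nu.+1) h i * expi (- (2 * pi * i%:R * k%:R / L%:R)).

Definition mmse_filter L snr (H : 'M[R[i]]_L) : 'M[R[i]]_L :=
  invmx (H^t* *m H + (snr^-1)%:C%C%:M) *m H^t*.

(* With y = sqrt snr *: H *m x + n, the receiver output on stream k is
     G k k * x_k + \sum_(l != k) G k l * x_l + \sum_l W k l * n_l,
   where the x_l are uncorrelated with unit power and n has covariance 1.
   Unbiased means that the coefficient G k k of the desired symbol is accounted
   for exactly, so that all the rest is interference plus noise. *)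
Definition mmse_sinr L snr (H : 'M[R[i]]_L) (k : 'I_L) : R :=
  let W := mmse_filter snr H in
  let G := (Num.sqrt snr)%:C%C *: (W *m H) in
  normc (G k k) ^+ 2 /
  (\sum_(l < L | l != k) normc (G k l) ^+ 2 + \sum_(l < L) normc (W k l) ^+ 2).

Definition mutual_information L snr (H : 'M[R[i]]_L) (k : 'I_L) : R :=
  log2 (1 + mmse_sinr snr H k).

End Channel.

(* The decision-point SINR does not depend on the stream: for all k,
     mmse_sinr snr (circulant_channel L h) k
       = (1/L \sum_i 1 / (1 + snr |channel_eigenvalue h i|^2))^-1 - 1. *)
Section ClosedForm.
Context {R : realType}.
Implicit Types (snr t : R).

Let expiD s t : expi (s + t) = expi s * expi t.
Proof.
rewrite /expi cosD sinD; apply/eqP; rewrite eq_complex /=.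
by apply/andP; split; apply/eqP; ring.
Qed.

Let expi0 : expi 0 = 1 :> R[i].
Proof. by rewrite /expi cos0 sin0. Qed.

Let expiMn t n : expi t ^+ n = expi (n%:R * t).
Proof.
elim: n => [|n IH]; first by rewrite mul0r expr0 expi0.
by rewrite exprS IH -expiD -natr1 mulrDl mul1r addrC.
Qed.

Let expi_conj t : (expi t)^* = expi (- t).
Proof. by rewrite /expi cosN sinN. Qed.

Let expi_neq1 t : 0 < t < 2 * pi -> expi t != 1.
Proof.
move=> /andP[t0 t2]; rewrite eq_complex /= negb_and; apply/orP; left.
have -> : t = (t / 2) *+ 2 by rewrite -mulr_natr; field.
rewrite cos_mulr2n cos2sin2; have : 0 < sin (t / 2) by apply: sin_gt0_pi; lra.
move=> s0; have : 0 < sin (t / 2) ^+ 2 by rewrite exprn_gt0.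
by move=> ?; apply/eqP; rewrite -mulr_natr; lra.
Qed.

Let normc2 (z : R[i]) : ((normc z) ^+ 2)%:C%C = z * z^*.
Proof. by rewrite rmorphXn /= -sqr_normc normc_def; case: z. Qed.

Variables (nu L : nat) (h : 'I_nu.+1 -> R[i]).
Hypothesis nuL : (nu < L)%N.

Let L0 : (0 < L)%N. Proof. exact: leq_ltn_trans nuL. Qed.
Let LR0 : L%:R != 0 :> R. Proof. by rewrite pnatr_eq0 -lt0n. Qed.
Let LC0 : L%:R != 0 :> R[i]. Proof. by rewrite pnatr_eq0 -lt0n. Qed.

Let w : R[i] := expi (- (2 * pi / L%:R)).

Let wL : w ^+ L = 1.
Proof.
rewrite /w expiMn mulrN mulrC divfK // /expi cosN sinN mulrC mulr_natr.
by rewrite cos2pi sin2pi oppr0.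
Qed.

Let w_mod n : w ^+ (n %% L) = w ^+ n.
Proof. by rewrite {2}(divn_eq n L) exprD mulnC exprM wL expr1n mul1r. Qed.

Let w_pow_conj n l : w ^+ n * (w ^+ l)^* = expi (2 * pi * (l%:R - n%:R) / L%:R).
Proof. by rewrite /w !expiMn expi_conj -expiD; congr expi; ring. Qed.

Let V : 'M[R[i]]_L := \matrix_(j, k) w ^+ (j * k).

Let w_sum (i l : 'I_L) :
  \sum_(j < L) (w ^+ i * (w ^+ l)^*) ^+ j = if i == l then L%:R else 0.
Proof.
have [->|il] := eqVneq i l.
  rewrite w_pow_conj subrr mulr0 mul0r expi0.
  by under eq_bigr do rewrite expr1n; rewrite sumr_const card_ord.
set x := (X in \sum_(j < L) X ^+ j).
have xL : x ^+ L = 1.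
  rewrite /x exprMn -rmorphXn -!exprM mulnC exprM wL.
  by rewrite mulnC exprM wL !expr1n rmorph1 mulr1.
apply/eqP; have := subrX1 x L; rewrite xL subrr => /esym/eqP.
rewrite mulf_eq0 subr_eq0 => /orP[|//]; rewrite /x.
have pos (a b : 'I_L) : (a < b)%N -> w ^+ a * (w ^+ b)^* != 1.
  move=> ab; rewrite w_pow_conj; apply: expi_neq1; have p0 := pi_gt0 R.
  have Lp : 0 < L%:R :> R by rewrite ltr0n.
  rewrite -natrB; last exact: ltnW.
  rewrite divr_gt0 ?mulr_gt0 ?ltr0n ?subn_gt0 //=.
  rewrite ltr_pdivrMr // ltr_pM2l ?mulr_gt0 // ltr_nat.
  by rewrite (leq_ltn_trans _ (ltn_ord b)) ?leq_subr.
move: il; rewrite -val_eqE neq_ltn => /orP[/pos/negP//|/pos/negP + /eqP e].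
by rewrite -[w ^+ l]conjCK mulrC -rmorphM e rmorph1 eqxx.
Qed.

Let VV : V *m V^t* = L%:R%:M.
Proof.
apply/matrixP => i l; rewrite !mxE.
have -> : L%:R *+ (i == l) = if i == l then L%:R else 0 :> R[i] by case: eqP.
rewrite -w_sum; apply: eq_bigr => j _; rewrite !mxE exprMn -exprM.
by congr (_ * _); rewrite exprM rmorphXn.
Qed.

Let spec (d : 'I_L -> R[i]) : 'M[R[i]]_L :=
  L%:R^-1 *: (V *m diag_mx (\row_k d k) *m V^t*).

Let VV' : V^t* *m V = L%:R%:M.
Proof.
have /mulmx1C : (L%:R^-1 *: V) *m V^t* = 1%:M.
  by rewrite -scalemxAl VV scale_scalar_mx mulVf.
rewrite -scalemxAr => /(congr1 (fun A => L%:R *: A)).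
by rewrite scalerA (mulfV LC0) scale1r scale_scalar_mx mulr1.
Qed.

Let specM d e : spec d *m spec e = spec (fun k => d k * e k).
Proof.
have -> : spec (fun k => d k * e k) =
    L%:R^-1 *: (V *m diag_mx (\row_k d k) *m diag_mx (\row_k e k) *m V^t*).
  rewrite /spec -[V *m _ *m diag_mx _]mulmxA mulmx_diag.
  suff -> : \row_k (d k * e k) =
    \row_j ((\row_k d k) ord0 j * (\row_k e k) ord0 j) by [].
  by apply/rowP => k; rewrite !mxE.
rewrite /spec -scalemxAl -scalemxAr scalerA !mulmxA.
rewrite -[_ *m V^t* *m V]mulmxA VV' mul_mx_scalar -!scalemxAl scalerA.
by rewrite (divfK LC0).
Qed.

Let specC d : (spec d)^t* = spec (fun k => (d k)^*%R).
Proof.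
rewrite /spec linearZ /= map_mxZ /= fmorphV rmorph_nat; congr (_ *: _).
rewrite !trmx_mul !map_mxM -mulmxA tr_diag_mx map_diag_mx trmxCK.
by congr (_ *m (diag_mx _ *m _)); apply/rowP => k; rewrite !mxE.
Qed.

Let spec1 s : spec (fun=> s) = s%:M.
Proof.
rewrite /spec; have -> : \row_(k < L) s = const_mx s by apply/rowP=> k; rewrite !mxE.
rewrite diag_const_mx mul_mx_scalar -scalemxAl VV !scale_scalar_mx.
by congr (_%:M); rewrite mulrCA mulVf // mulr1.
Qed.

Let specD d e : spec d + spec e = spec (fun k => d k + e k).
Proof.
rewrite /spec; have -> : \row_k (d k + e k) = \row_k d k + \row_k e k.
  by apply/rowP => k; rewrite !mxE.
by rewrite linearD /= mulmxDr mulmxDl scalerDr.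
Qed.

Let spec_diag d k : spec d k k = L%:R^-1 * \sum_i d i.
Proof.
rewrite !mxE; congr (_ * _); apply: eq_bigr => j _.
rewrite mul_mx_diag !mxE mulrAC -[RHS]mul1r; congr (_ * _).
rewrite exprM rmorphXn -exprMn.
by rewrite w_pow_conj subrr mulr0 mul0r expi0 expr1n.
Qed.

Let spec_row d k :
  \sum_l spec d k l * (spec d k l)^*%R = L%:R^-1 * \sum_i d i * (d i)^*%R.
Proof.
rewrite -(spec_diag (fun i => d i * (d i)^*%R) k) -specM -specC mxE.
by apply: eq_bigr => l _; rewrite !mxE.
Qed.

Let circulantV :
  circulant_channel L h *m V =
  V *m diag_mx (\row_k channel_eigenvalue h k).
Proof.
apply/matrixP => i k; rewrite mul_mx_diag !mxE.
pose f (m : 'I_L) : 'I_L := Ordinal (ltn_pmod (i + m) L0).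
have f_inj : injective f.
  move=> m n /(congr1 val) /= /eqP; rewrite eqn_modDl !modn_small //.
  by move/eqP/val_inj.
rewrite (reindex_inj f_inj) /=.
have fE (m : 'I_L) :
    circulant_channel L h i (f m) * V (f m) k =
    w ^+ (i * k) * (channel_tap h m * w ^+ (m * k)).
  rewrite !mxE /= -addnBA; last exact: ltnW.
  rewrite modnDml addnAC subnKC; last exact: ltnW.
  rewrite modnDl modn_small // mulrCA; congr (_ * _).
  by rewrite exprM w_mod exprD exprMn -!exprM.
rewrite (eq_bigr _ (fun m _ => fE m)) -mulr_sumr; congr (_ * _).
rewrite -(big_mkord xpredT (fun m => channel_tap h m * w ^+ (m * k))) /=.
rewrite (big_cat_nat _ (n := nu.+1)) //= [X in _ + X]big1_seq ?addr0; last first.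
  move=> m /=; rewrite mem_index_iota => /andP[num _].
  by rewrite /channel_tap ltnNge num mul0r.
rewrite big_mkord; apply: eq_bigr => m _.
rewrite /channel_tap ltn_ord inord_val /w expiMn; congr (_ * expi _).
by rewrite natrM; ring.
Qed.

Let circulantE : circulant_channel L h = spec (channel_eigenvalue h).
Proof.
rewrite /spec -circulantV -mulmxA VV mul_mx_scalar scalerA mulVf //.
by rewrite scale1r.
Qed.

Lemma mmse_sinrE snr (k : 'I_L) : 0 < snr ->
  mmse_sinr snr (circulant_channel L h) k =
  (L%:R^-1 * \sum_(i < L)
     (1 + snr * normc (channel_eigenvalue h i) ^+ 2)^-1)^-1 - 1.
Proof.
move=> snr0; set H := circulant_channel L h.
pose n (i : 'I_L) : R := normc (channel_eigenvalue h i) ^+ 2.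
pose p i := n i + snr^-1; pose g i := n i / p i.
have n0 i : 0 <= n i by exact: sqr_ge0.
have p0 i : 0 < p i by rewrite ltr_wpDl // invr_gt0.
have snr'0 : snr != 0 by rewrite gt_eqF.
have p'E i : n i * snr + 1 = snr * p i by rewrite /p mulrDr mulfV // mulrC.
have p'0 i : p i != 0 by rewrite gt_eqF.
have nE i : (channel_eigenvalue h i)^*%R * channel_eigenvalue h i = (n i)%:C%C.
  by rewrite mulrC /n normc2.
have WE : mmse_filter snr H =
    spec (fun i => (p i)^-1%:C%C * (channel_eigenvalue h i)^*%R).
  rewrite /mmse_filter /H circulantE specC specM -spec1 specD.
  rewrite -specM; congr (_ *m _); set A := spec _; set B := spec _.
  have AB : A *m B = 1%:M.
    rewrite specM -spec1; congr spec; apply/funext => i.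
    by rewrite nE -rmorphD -rmorphM -/(p i) mulfV ?rmorph1 // gt_eqF.
  have [uA _] := mulmx1_unit AB.
  by rewrite -[LHS]mulmx1 -AB mulKmx.
have GE : mmse_filter snr H *m H = spec (fun i => (g i)%:C%C).
  rewrite WE [H]circulantE specM; congr spec; apply/funext => i.
  by rewrite -mulrA nE -rmorphM /= mulrC.
pose avg (f : 'I_L -> R) := L%:R^-1 * \sum_i f i.
have normcR (x : R) : normc x%:C%C ^+ 2 = x ^+ 2.
  by rewrite /normc /= [0 ^+ 2]expr0n /= addr0 sqr_sqrtr // sqr_ge0.
have avgE (f : 'I_L -> R) : (avg f)%:C%C = L%:R^-1 * \sum_i (f i)%:C%C.
  by rewrite /avg rmorphM rmorph_sum /= fmorphV rmorph_nat.
have rowE d : \sum_l normc (spec d k l) ^+ 2 = avg (fun i => normc (d i) ^+ 2).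
  apply: (@complexI R); rewrite avgE rmorph_sum /=.
  rewrite [in RHS](eq_bigr _ (fun i _ => normc2 (d i))) -(spec_row d k).
  by apply: eq_bigr => l _; rewrite normc2.
set G := (Num.sqrt snr)%:C%C *: (mmse_filter snr H *m H).
have GEn l : normc (G k l) ^+ 2 = snr * normc (spec (fun i => (g i)%:C%C) k l) ^+ 2.
  by rewrite /G GE mxE normcM exprMn normcR sqr_sqrtr // ltW.
have Gdiag : normc (G k k) ^+ 2 = snr * avg g ^+ 2.
  by rewrite GEn spec_diag -avgE normcR.
have Grow : \sum_(l < L | l != k) normc (G k l) ^+ 2 =
    snr * avg (fun i => g i ^+ 2) - snr * avg g ^+ 2.
  apply/esym/eqP; rewrite subr_eq -Gdiag addrC; apply/eqP.
  have -> : snr * avg (fun i => g i ^+ 2) = \sum_l normc (G k l) ^+ 2.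
    rewrite (eq_bigr _ (fun l _ => GEn l)) -mulr_sumr rowE.
    by congr (_ * (_ * _)); apply: eq_bigr => i _; rewrite normcR.
  by rewrite (bigD1 k).
have Wrow : \sum_(l < L) normc (mmse_filter snr H k l) ^+ 2 =
    avg (fun i => n i / p i ^+ 2).
  rewrite WE rowE; congr (_ * _); apply: eq_bigr => i _.
  rewrite normcM exprMn normcR exprVn mulrC; congr (_ / _).
  by apply: (@complexI R); rewrite normc2 conjCK nE.
have tot : snr * avg (fun i => g i ^+ 2) + avg (fun i => n i / p i ^+ 2) =
    snr * avg g.
  rewrite /avg mulrCA -mulrDr [RHS]mulrCA; congr (_ * _).
  rewrite !mulr_sumr -big_split; apply: eq_bigr => i _ /=.
  have q0 := p'0 i; rewrite /g /p; field.
  by rewrite snr'0 p'E mulf_neq0.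
pose b := avg (fun i => (1 + snr * n i)^-1).
have bE : b = 1 - avg g.
  have -> : 1 = avg (fun=> 1).
    by rewrite /avg sumr_const card_ord mulVf.
  rewrite /b /avg -mulrBr -sumrB; congr (_ * _); apply: eq_bigr => i _.
  rewrite /g /p; field.
  by rewrite snr'0 p'E mulf_neq0 //= addrC mulrC p'E mulf_neq0.
have b0 : 0 < b.
  rewrite /b /avg mulr_gt0 ?invr_gt0 ?ltr0n // (bigD1 k) //=.
  have pos i : 0 < (1 + snr * n i)^-1.
    by rewrite invr_gt0 ltr_pwDl // mulr_ge0 // ltW.
  by rewrite ltr_pwDl // sumr_ge0 // => i _; exact/ltW.
have final (c : R) : 0 < c -> c = 1 - avg g ->
    snr * avg g ^+ 2 / (snr * avg g - snr * avg g ^+ 2) = c^-1 - 1.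
  move=> c0 cE; have -> : avg g = 1 - c by rewrite cE; ring.
  have [->|c1] := eqVneq c 1.
    by rewrite subrr expr0n /= !mulr0 mul0r invr1 subrr.
  have c1' : 1 - c != 0 by rewrite subr_eq0 eq_sym.
  have cn0 : c != 0 by rewrite gt_eqF.
  have -> : snr * (1 - c) - snr * (1 - c) ^+ 2 = snr * (1 - c) * c by ring.
  by field; rewrite snr'0 c1' cn0.
rewrite /mmse_sinr -/G Gdiag Grow Wrow addrAC tot.
exact: final b0 bE.
Qed.

End ClosedForm.

Section Outage.
Context {d : measure_display} {T : measurableType d} {R : realType}.
Variable P : probability T R.

Definition ReIm (z : R[i]) : R * R := (complex.Re z, complex.Im z).

(* CN(0,1): independent real and imaginary parts, each normal with mean 0 and
   variance 1/2 (normal_prob takes the standard deviation). *)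
Definition standard_complex_gaussian (Z : T -> R[i]) : Prop :=
  measurable_fun [set: T] (ReIm \o Z) /\
  forall A : set (R * R), measurable A ->
    P ((ReIm \o Z) @^-1` A) =
    (normal_prob 0 (Num.sqrt 2^-1) \x normal_prob 0 (Num.sqrt 2^-1))%E A.

Definition mutually_independent (I : finType) (Z : I -> T -> R[i]) : Prop :=
  forall (J : {set I}) (A : I -> set (R * R)),
    (forall i, measurable (A i)) ->
    P (\bigcap_(i in [set` J]) ((ReIm \o Z i) @^-1` A i)) =
    (\prod_(i in J) P ((ReIm \o Z i) @^-1` A i))%E.

Definition outage_probability nu (h : 'I_nu.+1 -> T -> R[i]) (L : nat) (rate : R)
    (k : 'I_L) (snr : R) : R :=
  fine (P [set t | mutual_information snr (circulant_channel L (h ^~ t)) k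
                   < rate]).

Definition outage_exponent nu (h : 'I_nu.+1 -> T -> R[i]) (L : nat) (rate : R)
    (k : 'I_L) : R :=
  - lim (log2 (outage_probability h rate k snr) / log2 snr @[snr --> +oo]).

End Outage.

(* Both limits are required to exist. *)
Definition exp_equal {R : realType} (f g : R -> R) : Prop :=
  exists l : R,
    log2 (f snr) / log2 snr @[snr --> +oo] --> l /\
    log2 (g snr) / log2 snr @[snr --> +oo] --> l.

(* Main.v *)
(* Put c = 2^-R L, u_k = snr |lambda_k|^2, m = min (floor c, nu).  By
   mmse_sinrE, outage means \sum_k 1 / (1 + u_k) > c, and lambda_k is the value
   at the k-th of L distinct unit complex nodes of the polynomial with
   coefficients h_0, ..., h_nu.
   Lower bound: if m + 1 of the u_k (all of them when m = nu) are below a small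
   constant, the sum exceeds c; this has probability of order snr^-(m+1).
   Upper bound: since the sum exceeds m, sorting the u_k gives u_i <= C and
   u_i u_m <= C for i < m, i.e. the m + 1 smallest values are small.  Cutting
   the range of u_m into N pieces and using
     P (|lambda_k|^2 <= b_k for k < s) <= K \prod_(k < s) b_k   (s <= nu + 1),
   the outage probability is at most K_N snr^(-(m+1) + 1/N), for every N. *)
Require Import Defs.
From HB Require Import structures.
From mathcomp Require Import all_boot all_order all_algebra.
From mathcomp Require Import all_classical all_reals all_analysis.
From mathcomp.real_closed Require Import complex.
From mathcomp Require Import measurable_realfun ring lra.
Set Implicit Arguments.
Unset Strict Implicit.
Unset Printing Implicit Defensive.
Import Order.TTheory GRing.Theory Num.Theory.
Import numFieldTopology.Exports numFieldNormedType.Exports.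
Local Open Scope classical_set_scope.
Local Open Scope ring_scope.

(** * Boxes and conditioning on a sub-sigma-algebra *)

(** The L eigenvalues are linear forms in only nu + 1 taps, hence dependent, and no joint density of
    them is used. Smallness at chosen nodes is rewritten in triangular form, as closeness of each
    tap to a function of later ones, and the taps are then removed one at a time. The delicate case
    is c = m: the event then does not bound u_m, which may be arbitrarily large provided the u_i
    with i < m are of order 1 / u_m. This trade-off is why the range of u_m is sliced; with slices
    of ratio snr^(1/(N+1)), each costs only one such factor. *)

Section MeasurableComplex.
Context {d : measure_display} {T : measurableType d} {R : realType}.
Implicit Types Z W : T -> R[i].

(** The sigma-algebra is that of the type [T], so the same predicate also expresses measurability
    with respect to a sub-sigma-algebra, by retyping the domain. *)
Definition cmeasurable Z : Prop :=
  measurable_fun setT (fun t => complex.Re (Z t)) /\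
  measurable_fun setT (fun t => complex.Im (Z t)).

Lemma cmeasurableE Z : cmeasurable Z <-> measurable_fun setT (ReIm \o Z).
Proof.
split=> [[mRe mIm]|mZ]; first exact: measurable_fun_pair.
by split; [exact: (measurableT_comp measurable_fst mZ)
          |exact: (measurableT_comp measurable_snd mZ)].
Qed.

Lemma cmeasurable_cst (z : R[i]) : cmeasurable (fun=> z).
Proof. by split; exact: measurable_cst. Qed.

Lemma cmeasurableD Z W :
  cmeasurable Z -> cmeasurable W -> cmeasurable (fun t => Z t + W t).
Proof.
move=> [Z1 Z2] [W1 W2]; split.
- rewrite [X in measurable_fun _ X](_ : _ =
    (fun t => complex.Re (Z t)) \+ (fun t => complex.Re (W t))).
    exact: measurable_funD.
  by apply/funext => t /=; case: (Z t); case: (W t).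
- rewrite [X in measurable_fun _ X](_ : _ =
    (fun t => complex.Im (Z t)) \+ (fun t => complex.Im (W t))).
    exact: measurable_funD.
  by apply/funext => t /=; case: (Z t); case: (W t).
Qed.

Lemma cmeasurableM Z W :
  cmeasurable Z -> cmeasurable W -> cmeasurable (fun t => Z t * W t).
Proof.
move=> [Z1 Z2] [W1 W2]; split.
- rewrite [X in measurable_fun _ X](_ : _ =
    ((fun t => complex.Re (Z t)) \* (fun t => complex.Re (W t))) \-
    ((fun t => complex.Im (Z t)) \* (fun t => complex.Im (W t)))).
    by apply: measurable_funB; apply: measurable_funM.
  by apply/funext => t /=; case: (Z t); case: (W t).
- rewrite [X in measurable_fun _ X](_ : _ =
    ((fun t => complex.Re (Z t)) \* (fun t => complex.Im (W t))) \+
    ((fun t => complex.Im (Z t)) \* (fun t => complex.Re (W t)))).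
    by apply: measurable_funD; apply: measurable_funM.
  by apply/funext => t /=; case: (Z t); case: (W t).
Qed.

Lemma cmeasurable_sum (I : finType) (p : pred I) (F : I -> T -> R[i]) :
  (forall i, p i -> cmeasurable (F i)) ->
  cmeasurable (fun t => \sum_(i | p i) F i t).
Proof.
move=> mF; rewrite [X in cmeasurable X](_ : _ =
  (fun t => \sum_(i <- enum p) F i t)); last first.
  by apply/funext => t; rewrite big_enum.
have : {subset enum p <= p} by move=> i; rewrite mem_enum.
elim: (enum p) => [|i s IH] sp.
  by under eq_fun do rewrite big_nil; exact: cmeasurable_cst.
under eq_fun do rewrite big_cons; apply: cmeasurableD.
  by apply: mF; apply: sp; rewrite mem_head.
by apply: IH => j js; apply: sp; rewrite in_cons js orbT.
Qed.

Lemma measurable_le_set (f g : T -> R) :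
  measurable_fun setT f -> measurable_fun setT g ->
  measurable [set t | f t <= g t].
Proof.
move=> mf mg; have := measurable_fun_ler mf mg.
move=> /(_ measurableT [set true]); rewrite setTI => H.
rewrite [X in measurable X](_ : _ = (fun t => f t <= g t) @^-1` [set true]) //.
exact: H.
Qed.

Lemma measurable_normc_sqr Z : cmeasurable Z ->
  measurable_fun setT (fun t => ComplexField.Normc.normc (Z t) ^+ 2).
Proof.
move=> [Z1 Z2]; rewrite [X in measurable_fun _ X](_ : _ =
  (fun t => complex.Re (Z t) ^+ 2) \+ (fun t => complex.Im (Z t) ^+ 2)).
  by apply: measurable_funD; apply: measurable_funX.
apply/funext => t /=; case: (Z t) => a b /=.
by rewrite sqr_sqrtr // addr_ge0 // sqr_ge0.
Qed.

(** A square rather than a disc: its probability under a complex Gaussian factors into two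
    intervals, and the two shapes differ only by constant factors of the radius. *)
Definition box (z : R[i]) (r : R) : set (R * R) :=
  `[complex.Re z - r, complex.Re z + r] `*`
  `[complex.Im z - r, complex.Im z + r].

Lemma boxP z r (p : R * R) : box z r p <->
  `|p.1 - complex.Re z| <= r /\ `|p.2 - complex.Im z| <= r.
Proof. by rewrite /box /= !in_itv /= !ler_distl. Qed.

Lemma measurable_box z r : measurable (box z r).
Proof. by apply: measurableX; exact: measurable_itv. Qed.

Definition near_set Z W (r : R) : set T := [set t | box (W t) r (ReIm (Z t))].

Lemma near_setP Z W r t : near_set Z W r t <->
  `|complex.Re (Z t) - complex.Re (W t)| <= r /\
  `|complex.Im (Z t) - complex.Im (W t)| <= r.
Proof. exact: boxP. Qed.

Lemma measurable_near_set Z W r :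
  cmeasurable Z -> cmeasurable W -> measurable (near_set Z W r).
Proof.
move=> [Z1 Z2] [W1 W2].
rewrite [X in measurable X](_ : _ =
  [set t | `|complex.Re (Z t) - complex.Re (W t)| <= r] `&`
  [set t | `|complex.Im (Z t) - complex.Im (W t)| <= r]); last first.
  by apply/seteqP; split=> t /near_setP.
have mnorm (f g : T -> R) : measurable_fun setT f -> measurable_fun setT g ->
    measurable [set t | `|f t - g t| <= r].
  move=> mf mg; apply: measurable_le_set; last exact: measurable_cst.
  apply: (@measurableT_comp _ _ _ _ _ _ (fun x : R => `|x|)).
    exact: normr_measurable.
  exact: measurable_funB.
by apply: measurableI; apply: mnorm.
Qed.

End MeasurableComplex.

Section Independence.
Context {d : measure_display} {T : measurableType d} {R : realType}.
Variable P : probability T R.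
Local Open Scope ereal_scope.

(** The finite measures sending B to P (E [&] B) and to P E * P B agree on the pi-system [C], which
    contains the whole space, hence on the sigma-algebra it generates. *)
Lemma indep_sigma (E : set T) (C : set (set T)) :
  measurable E -> C `<=` measurable -> setI_closed C -> C setT ->
  (forall B, C B -> P (E `&` B) = P E * P B) ->
  forall B, <<s C >> B -> P (E `&` B) = P E * P B.
Proof.
move=> mE mC IC CT EC B sB.
have PE0 : (0 <= fine (P E))%R by exact: fine_ge0.
have PEE : P E = (fine (P E))%:E by rewrite fineK // fin_num_measure.
have restrE A : P (E `&` A) = mrestr P mE A by rewrite /mrestr setIC.
have scaleE A : P E * P A = mscale (NngNum PE0) P A by rewrite /mscale /= -PEE.
rewrite restrE scaleE.
apply: (@g_sigma_algebra_measure_unique d R T C mC (fun=> setT)) => //.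
- by apply/seteqP; split=> // t _; exists 0%N.
- by move=> A /EC; rewrite restrE scaleE.
- move=> _; have : P (E `&` setT) < +oo.
    by rewrite setIT (le_lt_trans (probability_le1 P mE)) ?ltry.
  by rewrite restrE.
Qed.

End Independence.

(* W is known given C, so P (|Z - W| <= r) can be estimated as if W were
   constant: instead of disintegrating, split T into the countably many
   C-measurable cells on which W varies by at most r, replace W by one of its
   values on each cell, and use independence cell by cell. *)
Section Conditioning.
Context {d : measure_display} {T : measurableType d} {R : realType}.
Variable P : probability T R.
Variable C : set (set T).
Hypothesis mC : C `<=` measurable.
Let TC := g_sigma_algebraType C.

Let sub_measurable (A : set T) : <<s C >> A -> measurable A.
Proof.
move=> sA; apply: (sA measurable); split => //.
exact: sigma_algebra_measurable.
Qed.

Lemma cmeasurable_sub (W : T -> R[i]) :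
  cmeasurable (W : TC -> R[i]) -> cmeasurable W.
Proof.
by move=> [W1 W2]; split=> _ Y mY; apply: sub_measurable;
  [exact: W1|exact: W2].
Qed.

(** The cells are the preimages under [W] of the squares of a grid of mesh r, numbered by encoding
    their pair of integer coordinates; numbers that are not attained give empty cells. *)
Lemma cell_partition (W : T -> R[i]) (r : R) : (0 < r)%R ->
  cmeasurable (W : TC -> R[i]) ->
  exists F : nat -> set T,
    [/\ forall n, <<s C >> (F n), trivIset setT F, \bigcup_n F n = setT &
     forall n t t', F n t -> F n t' -> box (W t') r (ReIm (W t))].
Proof.
move=> r0 [W1 W2].
pose q1 t : int := Num.floor (complex.Re (W t) / r).
pose q2 t : int := Num.floor (complex.Im (W t) / r).
pose q t := pickle (q1 t, q2 t).
have mfloor (f : T -> R) (z : int) :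
    measurable_fun setT (f : TC -> R) ->
    <<s C >> [set t | Num.floor (f t / r) = z].
  move=> mf.
  have -> : [set t | Num.floor (f t / r) = z] =
      f @^-1` (`[z%:~R * r, (z + 1)%:~R * r[%classic : set R).
    apply/seteqP; split=> t /=; rewrite in_itv /= -ler_pdivlMr // -ltr_pdivrMr //.
      by move=> <-; exact: Num.Theory.floor_itv.
    by exact: Num.Theory.floor_def.
  have := mf measurableT _ (measurable_itv `[z%:~R * r, (z + 1)%:~R * r[%R).
  by rewrite setTI.
exists (fun n => q @^-1` [set n]); split.
- move=> n.
  have [[t qt]|nq] := pselect (exists t, q t = n); last first.
    have -> : q @^-1` [set n] = set0.
      by apply/seteqP; split=> t //= qt; apply: nq; exists t.
    exact: (@measurable0 _ TC).
  have -> : q @^-1` [set n] = [set t' | q1 t' = q1 t] `&` [set t' | q2 t' = q2 t].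
    apply/seteqP; split=> t' /=; rewrite -qt.
      by move/(pcan_inj pickleK) => -[-> ->].
    by rewrite /q => -[-> ->].
  by apply: (@measurableI _ TC); apply: mfloor.
- by move=> i j _ _ [t [<- <-]].
- by apply/seteqP; split=> // t _; exists (q t).
- move=> n t t' /= <- /(pcan_inj pickleK)[e1 e2].
  have key (f : T -> R) : Num.floor (f t' / r) = Num.floor (f t / r) ->
      (`|f t - f t'| <= r)%R.
    move=> e; have /andP[a1 a2] := Num.Theory.floor_itv (f t / r).
    have /andP[b1 b2] := Num.Theory.floor_itv (f t' / r).
    rewrite e in b1 b2; move: a1 a2 b1 b2.
    rewrite !ler_pdivlMr // !ltr_pdivrMr // intrD mulrDl mul1r.
    by move: (_ * r)%R => x *; rewrite ler_distl; apply/andP; split; lra.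
  by apply/boxP; split=> /=; apply: (key (fun t => _ (W t))).
Qed.

Local Open Scope ereal_scope.

Variable Z : T -> R[i].
Hypothesis mZ : cmeasurable Z.
Hypothesis indep : forall (A : set (R * R)) G, measurable A -> <<s C >> G ->
  P ((ReIm \o Z) @^-1` A `&` G) = P ((ReIm \o Z) @^-1` A) * P G.

Let mZbox A : measurable A -> measurable ((ReIm \o Z) @^-1` A).
Proof.
move=> mA; rewrite -[X in measurable X]setTI.
by move/cmeasurableE : mZ; exact.
Qed.

Let partition_sum (F : nat -> set T) (E : set T) :
  (forall n, <<s C >> (F n)) -> trivIset setT F -> \bigcup_n F n = setT ->
  measurable E -> P E = \sum_(n <oo) P (F n `&` E).
Proof.
move=> sF tF cF mE.
rewrite -{1}[E]setTI -cF setI_bigcupl measure_bigcup //.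
- by apply: eq_eseriesl => n; exact: in_setT.
- by move=> n _; apply: measurableI => //; exact: sub_measurable.
- exact: trivIset_setIr.
Qed.

(** On a cell, [W] stays within r of one of its values, so the event lies in the fixed square of
    radius r + r around that value; hence [r *+ 2] in the hypothesis. *)
Lemma near_set_upper (W : T -> R[i]) (r kappa : R) (G : set T) :
  (0 < r)%R -> cmeasurable (W : TC -> R[i]) -> <<s C >> G ->
  (0 <= kappa)%R ->
  (forall w, P ((ReIm \o Z) @^-1` box w (r *+ 2)) <= kappa%:E) ->
  P (near_set Z W r `&` G) <= kappa%:E * P G.
Proof.
move=> r0 mW sG k0 ub; have [F [sF tF cF Fr]] := cell_partition r0 mW.
have mG := sub_measurable sG.
have mN : measurable (near_set Z W r).
  by apply: measurable_near_set => //; exact: cmeasurable_sub.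
rewrite (partition_sum sF tF cF (measurableI _ _ mN mG)).
rewrite (partition_sum sF tF cF mG) -nneseriesZl //.
apply: lee_nneseries => // n _.
have mF := sub_measurable (sF n).
have [F0|/set0P[t0 Ft0]] := eqVneq (F n) set0.
  by rewrite F0 !set0I measure0 mule0.
have sFG : <<s C >> (F n `&` G).
  by apply: (@measurableI _ TC); [exact: sF|exact: sG].
apply: (@le_trans _ _ (P ((ReIm \o Z) @^-1` box (W t0) (r *+ 2) `&` (F n `&` G)))).
  apply: le_measure; rewrite ?inE.
  - by apply: measurableI => //; exact: measurableI.
  - apply: measurableI; last exact: measurableI.
    by apply: mZbox; exact: measurable_box.
  - move=> t [Ft [/near_setP[n1 n2] Gt]]; split=> //.
    have /boxP[/= m1 m2] := Fr _ _ _ Ft Ft0.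
    by apply/boxP; split=> /=; rewrite mulr2n;
      [exact: le_trans (ler_distD _ _ _) (lerD n1 m1)
      |exact: le_trans (ler_distD _ _ _) (lerD n2 m2)].
rewrite indep //; last exact: measurable_box.
by rewrite lee_wpmul2r.
Qed.

(** With cells of mesh r / 2, the fixed square of radius r / 2 lies inside the moving square of
    radius r. The representative value is taken at a point of [G], so the bound is only required for
    centres attained on [G]. *)
Lemma near_set_lower (W : T -> R[i]) (r kappa : R) (G : set T) :
  (0 < r)%R -> cmeasurable (W : TC -> R[i]) -> <<s C >> G ->
  (0 <= kappa)%R ->
  (forall t, G t -> kappa%:E <= P ((ReIm \o Z) @^-1` box (W t) (r / 2))) ->
  kappa%:E * P G <= P (near_set Z W r `&` G).
Proof.
move=> r0 mW sG k0 lb.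
have r20 : (0 < r / 2)%R by rewrite divr_gt0.
have [F [sF tF cF Fr]] := cell_partition r20 mW.
have mG := sub_measurable sG.
have mN : measurable (near_set Z W r).
  by apply: measurable_near_set => //; exact: cmeasurable_sub.
rewrite (partition_sum sF tF cF (measurableI _ _ mN mG)).
rewrite (partition_sum sF tF cF mG) -nneseriesZl //.
apply: lee_nneseries => [n _ _|n _]; first by rewrite mule_ge0.
have mF := sub_measurable (sF n).
have sFG : <<s C >> (F n `&` G).
  by apply: (@measurableI _ TC); [exact: sF|exact: sG].
have [F0|/set0P[t0 [Ft0 Gt0]]] := eqVneq (F n `&` G) set0.
  by rewrite F0 measure0 mule0.
apply: (@le_trans _ _ (P ((ReIm \o Z) @^-1` box (W t0) (r / 2) `&` (F n `&` G)))).
  rewrite indep //; last exact: measurable_box.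
  by rewrite lee_wpmul2r // lb.
apply: le_measure; rewrite ?inE.
- apply: measurableI; last exact: measurableI.
  by apply: mZbox; exact: measurable_box.
- by apply: measurableI => //; exact: measurableI.
- move=> t [/boxP[/= n1 n2] [Ft Gt]]; split=> //; split=> //.
  have /boxP[/= m1 m2] := Fr _ _ _ Ft0 Ft.
  by apply/near_setP; split; rewrite [leRHS]splitr;
    [exact: le_trans (ler_distD _ _ _) (lerD n1 m1)
    |exact: le_trans (ler_distD _ _ _) (lerD n2 m2)].
Qed.

End Conditioning.

(** * Independent complex Gaussian taps *)

Section Gaussian.
Context {R : realType}.
Local Notation mu := (@lebesgue_measure R).
Local Notation itvc a r := [set` `[(a - r)%R, (a + r)%R]].
Variable s : R.
Hypothesis s0 : s != 0.

Let mpdf (D : set R) : measurable_fun D (EFin \o normal_pdf 0 s).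
Proof.
by apply/measurable_EFinP; apply: measurable_funTS; exact: measurable_normal_pdf.
Qed.

Lemma normal_itv_ub :
  exists2 K : R, 0 < K & forall a r, 0 <= r ->
    (normal_prob 0 s (itvc a r) <= (K * r)%:E)%E.
Proof.
exists (2 * normal_peak s); first by rewrite mulr_gt0 // normal_peak_gt0.
move=> a r r0.
apply: (@le_trans _ _ (\int[mu]_(x in (itvc a r)) (normal_peak s)%:E)%E).
  apply: ge0_le_integral => //=.
  - by move=> x _; rewrite lee_fin normal_pdf_ge0.
  - exact: mpdf.
  - by move=> x _; rewrite lee_fin normal_pdf_ub.
rewrite integral_cst //= lebesgue_measure_itv /= lte_fin.
case: ifP => _; last by rewrite mule0 lee_fin mulr_ge0 // mulr_ge0 // normal_peak_ge0.
by rewrite -EFinB -EFinM lee_fin le_eqVlt; apply/orP; left; apply/eqP; ring.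
Qed.

Lemma normal_itv_lb (A : R) :
  exists2 k : R, 0 < k & forall a r, `|a| <= A -> 0 < r <= 1 ->
    ((k * r)%:E <= normal_prob 0 s (itvc a r))%E.
Proof.
(* The density at |A| + 1, which is its minimum on [-(|A| + 1), |A| + 1]; this interval contains
   [a - r, a + r] because |a| <= A and r <= 1. *)
set m := normal_peak s * expR (- (`|A| + 1) ^+ 2 / (s ^+ 2 *+ 2)).
have m0 : 0 < m by rewrite mulr_gt0 ?expR_gt0 // normal_peak_gt0.
exists (2 * m); first by rewrite mulr_gt0.
move=> a r aA /andP[r0 r1].
apply: (@le_trans _ _ (\int[mu]_(x in (itvc a r)) m%:E)%E).
  rewrite integral_cst //= lebesgue_measure_itv /= lte_fin ifT; last by lra.
  by rewrite -EFinB -EFinM lee_fin le_eqVlt; apply/orP; left; apply/eqP; ring.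
apply: ge0_le_integral => //=.
- by move=> x _; rewrite lee_fin ltW.
- exact: mpdf.
- move=> x; rewrite /= in_itv /= => /andP[x1 x2].
  rewrite lee_fin normal_pdfE // /m ler_wpM2l ?normal_peak_ge0 // ler_expR subr0.
  rewrite ler_wpM2r ?invr_ge0 ?mulrn_wge0 ?sqr_ge0 // lerN2.
  rewrite -(real_normK (num_real x)) lerXn2r ?nnegrE ?addr_ge0 //.
  have := ler_norm A; move: aA; rewrite ler_norml => /andP[? ?] ?.
  by rewrite ler_norml; apply/andP; split; lra.
Qed.

End Gaussian.

Section GaussianBox.
Context {d : measure_display} {T : measurableType d} {R : realType}.
Variable P : probability T R.
Local Open Scope ereal_scope.

Let s0 : (Num.sqrt 2^-1 != 0 :> R)%R.
Proof. by rewrite gt_eqF // sqrtr_gt0 invr_gt0. Qed.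

Let boxE (Z : T -> R[i]) z r : standard_complex_gaussian P Z ->
  P ((ReIm \o Z) @^-1` box z r) =
  normal_prob 0%R (Num.sqrt 2^-1)%R [set` `[complex.Re z - r, complex.Re z + r]%R] *
  normal_prob 0%R (Num.sqrt 2^-1)%R [set` `[complex.Im z - r, complex.Im z + r]%R].
Proof.
move=> [_ ->]; last exact: measurable_box.
by rewrite /box product_measure1E.
Qed.

Lemma gaussian_box_ub : exists2 K : R, (0 < K)%R &
  forall Z : T -> R[i], standard_complex_gaussian P Z ->
  forall z r, (0 <= r)%R ->
    P ((ReIm \o Z) @^-1` box z r) <= (K * r ^+ 2)%:E.
Proof.
have [K K0 HK] := normal_itv_ub s0.
exists (K ^+ 2)%R; first by rewrite exprn_gt0.
move=> Z gZ z r r0; rewrite boxE // -exprMn expr2 EFinM.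
by apply: lee_pmul => //; exact: HK.
Qed.

Lemma gaussian_box_lb (A : R) : exists2 k : R, (0 < k)%R &
  forall Z : T -> R[i], standard_complex_gaussian P Z ->
  forall z r, (`|complex.Re z| <= A)%R -> (`|complex.Im z| <= A)%R ->
    (0 < r <= 1)%R ->
    (k * r ^+ 2)%:E <= P ((ReIm \o Z) @^-1` box z r).
Proof.
have [k k0 Hk] := normal_itv_lb s0 A.
exists (k ^+ 2)%R; first by rewrite exprn_gt0.
move=> Z gZ z r z1 z2 r01; rewrite boxE // -exprMn expr2 EFinM.
have kr0 : 0 <= (k * r)%:E.
  by case/andP: r01 => r0 _; rewrite lee_fin mulr_ge0 // ltW.
by apply: lee_pmul => //; exact: Hk.
Qed.

End GaussianBox.

Section Chain.
Context {d : measure_display} {T : measurableType d} {R : realType}.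
Variables (P : probability T R) (n : nat) (h : 'I_n -> T -> R[i]).
Hypothesis mh : forall i, cmeasurable (h i).
Hypothesis indep : mutually_independent P h.

(* A pi-system generating the sigma-algebra of the h_j with j >= i. *)
Definition tail_rect (i : nat) : set (set T) := [set B |
  exists A : 'I_n -> set (R * R), [/\ forall j, measurable (A j),
    forall j : 'I_n, (j < i)%N -> A j = setT &
    B = \bigcap_j ((ReIm \o h j) @^-1` A j)]].

Let mpre (j : 'I_n) A : measurable A -> measurable ((ReIm \o h j) @^-1` A).
Proof.
move=> mA; rewrite -[X in measurable X]setTI.
by have /cmeasurableE := mh j; exact.
Qed.

Lemma tail_rect_measurable i : tail_rect i `<=` measurable.
Proof.
move=> B [A [mA _ ->]]; apply: fin_bigcap_measurable => // j _.
exact: mpre.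
Qed.

Lemma tail_rect_setI i : setI_closed (tail_rect i).
Proof.
move=> B B' [A [mA A1 ->]] [A' [mA' A1' ->]].
exists (fun j => A j `&` A' j); split.
- by move=> j; exact: measurableI.
- by move=> j ji; rewrite A1 // A1' // setIT.
- by rewrite -bigcapI.
Qed.

Lemma tail_rect_setT i : tail_rect i setT.
Proof. by exists (fun=> setT); split=> //; rewrite bigcapT. Qed.

Lemma tail_rect_mono i i' : (i <= i')%N -> tail_rect i' `<=` tail_rect i.
Proof.
move=> ii' B [A [mA A1 ->]]; exists A; split=> // j ji.
by apply: A1; exact: leq_trans ii'.
Qed.

Lemma tail_rect_sigma_measurable i B : <<s tail_rect i >> B -> measurable B.
Proof.
move=> sB; apply: (sB measurable); split; first exact: sigma_algebra_measurable.
exact: tail_rect_measurable.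
Qed.

Lemma tail_rect_prob A : (forall j, measurable (A j)) ->
  P (\bigcap_j ((ReIm \o h j) @^-1` A j)) =
  (\prod_j P ((ReIm \o h j) @^-1` A j))%E.
Proof.
move=> mA; have := indep (finset.setT : {set 'I_n}) mA.
rewrite (_ : [set` _] = setT); last first.
  by apply/seteqP; split=> j //= _; rewrite finset.in_setT.
by move=> ->; apply: eq_bigl => j; rewrite finset.in_setT.
Qed.

(** A rectangle of the generating pi-system leaves coordinate i free, so intersecting it with a
    condition on h_i gives again a rectangle, whose probability is a product. *)
Lemma tail_indep (i : 'I_n) (A : set (R * R)) G :
  measurable A -> <<s tail_rect i.+1 >> G ->
  (P ((ReIm \o h i) @^-1` A `&` G) = P ((ReIm \o h i) @^-1` A) * P G)%E.
Proof.
move=> mA; apply: indep_sigma.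
- exact: mpre.
- exact: tail_rect_measurable.
- exact: tail_rect_setI.
- exact: tail_rect_setT.
move=> _ [B [mB B1 ->]].
pose B' j := if j == i then A else B j.
have mB' j : measurable (B' j) by rewrite /B'; case: ifP.
have -> : (ReIm \o h i) @^-1` A `&` \bigcap_j ((ReIm \o h j) @^-1` B j) =
    \bigcap_j ((ReIm \o h j) @^-1` B' j).
  apply/seteqP; split=> t /=.
    by move=> [At Bt] j _ /=; rewrite /B'; case: eqP => [->//|_]; exact: Bt.
  move=> Bt; split; first by have := Bt i I; rewrite /= /B' eqxx.
  move=> j _; have := Bt j I; rewrite /= /B'; case: eqP => [->|//] _.
  by rewrite B1.
rewrite !tail_rect_prob // (bigD1 i) //= [in RHS](bigD1 i) //=.
rewrite {1}/B' eqxx B1 // preimage_setT probability_setT mul1e; congr (_ * _)%E.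
by apply: eq_bigr => j /negbTE ji; rewrite /B' ji.
Qed.

Lemma tail_cmeasurable (i : nat) (j : 'I_n) : (i <= j)%N ->
  cmeasurable (h j : g_sigma_algebraType (tail_rect i) -> R[i]).
Proof.
move=> ij; apply/cmeasurableE => _ Y mY; rewrite setTI.
apply: sub_sigma_algebra; exists (fun j' => if j' == j then Y else setT).
split.
- by move=> j'; case: ifP.
- by move=> j' j'i; case: eqP => // e; move: j'i; rewrite e ltnNge ij.
- apply/seteqP; split=> t /=; last by move=> /(_ j I); rewrite /= eqxx.
  by move=> Yt j' _ /=; case: eqP => [->|].
Qed.

Lemma cmeasurable_tail_mono i i' (W : T -> R[i]) : (i <= i')%N ->
  cmeasurable (W : g_sigma_algebraType (tail_rect i') -> R[i]) ->
  cmeasurable (W : g_sigma_algebraType (tail_rect i) -> R[i]).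
Proof.
move=> ii' [W1 W2].
have sub : <<s tail_rect i' >> `<=` <<s tail_rect i >>.
  by apply: sub_sigma_algebra2; exact: tail_rect_mono.
by split=> _ Y mY; apply: sub; [exact: W1|exact: W2].
Qed.

Variables (s : nat) (sn : (s <= n)%N).
Variables (f : 'I_n -> T -> R[i]) (rho kappa : 'I_n -> R) (B : set T).
Hypothesis mf : forall i : 'I_n, (i < s)%N ->
  cmeasurable (f i : g_sigma_algebraType (tail_rect i.+1) -> R[i]).
Hypothesis rho0 : forall i, 0 < rho i.
Hypothesis kappa0 : forall i, 0 <= kappa i.
Hypothesis sB : <<s tail_rect s >> B.

(** [B] constrains the taps from s on. Going from i + 1 to i adds one condition on h_i, whose centre
    depends only on later taps. *)
Definition chain (i : nat) : set T := B `&`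
  [set t | forall j : 'I_n, (i <= j < s)%N -> near_set (h j) (f j) (rho j) t].

Lemma chain_end : chain s = B.
Proof.
apply/seteqP; split=> t; first by case.
move=> Bt; split=> // j /andP[sj js].
by move: (leq_ltn_trans sj js); rewrite ltnn.
Qed.

Lemma chain_step (i : 'I_n) : (i < s)%N ->
  chain i = near_set (h i) (f i) (rho i) `&` chain i.+1.
Proof.
move=> si; apply/seteqP; split=> t.
  move=> [Bt Ht]; split; first by apply: Ht; rewrite leqnn.
  by split=> // j /andP[ij js]; apply: Ht; rewrite ltnW.
move=> [it [Bt Ht]]; split=> // j /andP[]; rewrite leq_eqVlt => /orP[/eqP e|ij] js.
  by have <- : i = j by apply: val_inj.
by apply: Ht; rewrite ij.
Qed.

Lemma chain_ind (Q : nat -> Prop) : Q s ->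
  (forall i : 'I_n, (i < s)%N -> Q i.+1 -> Q i) ->
  forall i, (i <= s)%N -> Q i.
Proof.
move=> Qs IH i si; rewrite -(subKn si); elim: (s - i)%N (leq_subr i s).
  by rewrite subn0.
move=> k IHk ks.
have lt : (s - k.+1 < s)%N by rewrite ltn_subrL (leq_trans _ ks).
have ltn := leq_trans lt sn.
by apply: (IH (Ordinal ltn)) => //=; rewrite -subSn // subSS; apply: IHk; exact: ltnW.
Qed.

Lemma chain_sigma i : (i <= s)%N -> <<s tail_rect i >> (chain i).
Proof.
move: i; apply: chain_ind; first by rewrite chain_end.
move=> i si IH; rewrite chain_step //.
apply: (@measurableI _ (g_sigma_algebraType (tail_rect i))).
  apply: (@measurable_near_set _ (g_sigma_algebraType (tail_rect i))).
    exact: tail_cmeasurable.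
  exact: (cmeasurable_tail_mono (leqnSn i) (mf si)).
have sub : <<s tail_rect i.+1 >> `<=` <<s tail_rect i >>.
  by apply: sub_sigma_algebra2; exact: tail_rect_mono.
exact: (sub _ IH).
Qed.

Let big_step (i : 'I_n) : (i < s)%N ->
  \prod_(j < n | (i <= j < s)%N) kappa j =
  kappa i * \prod_(j < n | (i.+1 <= j < s)%N) kappa j.
Proof.
move=> si; rewrite (bigD1 i) ?leqnn //=; congr (_ * _); apply: eq_bigl => j.
by rewrite (ltn_neqAle i) -(inj_eq val_inj) [_ == val i]eq_sym andbC andbA.
Qed.

Let big_end : \prod_(j < n | (s <= j < s)%N) kappa j = 1.
Proof.
apply: big1 => j /andP[sj js].
by move: (leq_ltn_trans sj js); rewrite ltnn.
Qed.

(** [chain i.+1] lies in the sigma-algebra of the taps after i, of which h_i is independent, so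
    adding the condition on h_i costs a factor kappa_i. *)
Lemma chain_upper :
  (forall (i : 'I_n) w, (i < s)%N ->
    P ((ReIm \o h i) @^-1` box w (rho i *+ 2)) <= (kappa i)%:E)%E ->
  (P (chain 0) <= (\prod_(j < n | (j < s)%N) kappa j)%:E * P B)%E.
Proof.
move=> ub.
suff /(_ 0%N (leq0n s)) : forall i, (i <= s)%N ->
    (P (chain i) <= (\prod_(j < n | (i <= j < s)%N) kappa j)%:E * P B)%E by [].
apply: chain_ind; first by rewrite chain_end big_end mul1e.
move=> i si IH; rewrite chain_step // big_step // EFinM -muleA.
apply: (le_trans (near_set_upper (tail_rect_measurable (i := i.+1)) (mh i)
  (@tail_indep i) (rho0 i) (mf si) (chain_sigma si) (kappa0 i) _)).
  by move=> w; exact: ub.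
by rewrite lee_wpmul2l ?lee_fin.
Qed.

(** Dual to the upper bound, but the box estimate is required only on [B]: Gaussian boxes have a
    uniform lower bound only for bounded centres, and [B] will supply that boundedness. *)
Lemma chain_lower :
  (forall (i : 'I_n) t, (i < s)%N -> B t ->
    (kappa i)%:E <= P ((ReIm \o h i) @^-1` box (f i t) (rho i / 2)))%E ->
  ((\prod_(j < n | (j < s)%N) kappa j)%:E * P B <= P (chain 0))%E.
Proof.
move=> lb.
suff /(_ 0%N (leq0n s)) : forall i, (i <= s)%N ->
    ((\prod_(j < n | (i <= j < s)%N) kappa j)%:E * P B <= P (chain i))%E by [].
apply: chain_ind; first by rewrite chain_end big_end mul1e.
move=> i si IH; rewrite chain_step // big_step // EFinM -muleA.
apply: (le_trans _ (near_set_lower (tail_rect_measurable (i := i.+1)) (mh i)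
  (@tail_indep i) (rho0 i) (mf si) (chain_sigma si) (kappa0 i) _)).
  by rewrite lee_wpmul2l ?lee_fin.
by move=> t [Bt _]; exact: lb.
Qed.

End Chain.

(** * Small values of a random polynomial at distinct nodes *)

Section ComplexModulus.
Context {R : realType}.
Implicit Types z w : R[i].
Local Notation normc := ComplexField.Normc.normc.

Lemma normc_ge0 z : 0 <= normc z.
Proof. by case: z => a b; exact: sqrtr_ge0. Qed.

Lemma le_normc_sum (I : Type) (r : seq I) (p : pred I) (F : I -> R[i]) :
  normc (\sum_(i <- r | p i) F i) <= \sum_(i <- r | p i) normc (F i).
Proof.
elim/big_rec2: _ => [|i x z _ H]; first by rewrite ComplexField.Normc.normc0.
by apply: (le_trans (le_normcD _ _)); rewrite lerD2l.
Qed.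

Lemma normcX z n : normc (z ^+ n) = normc z ^+ n.
Proof.
elim: n => [|n IH]; first exact: ComplexField.Normc.normc1.
by rewrite !exprS ComplexField.Normc.normcM IH.
Qed.

Lemma le_Re_normc z : `|complex.Re z| <= normc z.
Proof.
by case: z => a b /=; rewrite -sqrtr_sqr ler_wsqrtr // lerDl sqr_ge0.
Qed.

Lemma le_Im_normc z : `|complex.Im z| <= normc z.
Proof.
by case: z => a b /=; rewrite -sqrtr_sqr ler_wsqrtr // lerDr sqr_ge0.
Qed.

Lemma normc_le_ReIm z : normc z <= `|complex.Re z| + `|complex.Im z|.
Proof.
case: z => a b /=.
rewrite -(ler_sqr (sqrtr_ge0 _)) ?nnegrE ?addr_ge0 // sqr_sqrtr ?addr_ge0 ?sqr_ge0 //.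
rewrite sqrrD !real_normK ?num_real // addrAC lerDl.
by rewrite mulrn_wge0 // mulr_ge0.
Qed.

Lemma normc_expi (t : R) : normc (expi t) = 1.
Proof. by rewrite /expi /= cos2Dsin2 sqrtr1. Qed.

Lemma near_set_normc d (T : measurableType d) (Z W : T -> R[i]) r t :
  normc (Z t - W t) <= r -> near_set Z W r t.
Proof.
move=> H; apply/boxP => /=; split; apply: le_trans H.
  by have := le_Re_normc (Z t - W t); case: (Z t); case: (W t).
by have := le_Im_normc (Z t - W t); case: (Z t); case: (W t).
Qed.

Lemma normc_near_set d (T : measurableType d) (Z W : T -> R[i]) r t :
  near_set Z W r t -> normc (Z t - W t) <= r *+ 2.
Proof.
move=> /boxP[/= H1 H2]; apply: (le_trans (normc_le_ReIm _)).
by rewrite mulr2n; move: H1 H2; case: (Z t) => a b; case: (W t) => a' b' /=; exact: lerD.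
Qed.

End ComplexModulus.

Section Vandermonde.
Context {F : fieldType}.
Variables (m : nat) (y : nat -> F).
Hypothesis y_inj : forall i j, (i < m)%N -> (j < m)%N -> y i = y j -> i = j.

Let V := Vandermonde m (\row_(k < m) y k).

Let unitV : V \in unitmx.
Proof.
rewrite unitmxE unitfE det_Vandermonde; apply/prodf_neq0 => i _.
apply/prodf_neq0 => j ij; rewrite !mxE subr_eq0; apply/eqP => /y_inj ji.
by move: ij; rewrite ji ?ltnn.
Qed.

Lemma vandermonde_interpolation (z : nat -> F) :
  exists v : 'I_m -> F, forall k : 'I_m, \sum_i v i * y k ^+ i = z k.
Proof.
exists (fun i => ((\row_k z k) *m invmx V) 0 i) => k.
have := congr1 (fun A : 'rV_m => A 0 k) (mulmxKV unitV (\row_k z k)).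
by rewrite /= !mxE => <-; apply: eq_bigr => i _; rewrite [V _ _]mxE !mxE.
Qed.

(** The transposed system: weights on the nodes whose combination of evaluations takes prescribed
    values on the monomials of degree < m. Prescribing 0, ..., 0, 1 gives the divided difference. *)
Lemma vandermonde_dual (z : nat -> F) :
  exists b : 'I_m -> F, forall j : 'I_m, \sum_k b k * y k ^+ j = z j.
Proof.
exists (fun k => (invmx V *m (\col_j z j)) k 0) => j.
have := congr1 (fun A : 'cV_m => A j 0) (mulKVmx unitV (\col_j z j)).
by rewrite /= !mxE => <-; apply: eq_bigr => k _; rewrite [V _ _]mxE !mxE mulrC.
Qed.

End Vandermonde.

Section SmallValues.
Context {d : measure_display} {T : measurableType d} {R : realType}.
Variables (P : probability T R) (n : nat) (h : 'I_n -> T -> R[i]).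
Hypothesis gaussian_h : forall i, standard_complex_gaussian P (h i).
Hypothesis indep : mutually_independent P h.
Local Notation normc := ComplexField.Normc.normc.

Let mh i : cmeasurable (h i).
Proof. by apply/cmeasurableE; have [] := gaussian_h i. Qed.

Definition tap_poly (x : R[i]) (t : T) : R[i] := \sum_i h i t * x ^+ i.

Lemma cmeasurable_tap_poly x : cmeasurable (tap_poly x).
Proof.
apply: cmeasurable_sum => i _.
by apply: cmeasurableM => //; exact: cmeasurable_cst.
Qed.

Variables (s : nat) (y : nat -> R[i]).
Hypothesis sn : (s <= n)%N.
Hypothesis y_inj : forall i j, (i < s)%N -> (j < s)%N -> y i = y j -> i = j.

Definition small_values (b : nat -> R) : set T :=
  [set t | forall k, (k < s)%N -> normc (tap_poly (y k) t) ^+ 2 <= b k].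

Lemma measurable_small_values b : measurable (small_values b).
Proof.
have -> : small_values b = \bigcap_(k in `I_s)
    [set t | normc (tap_poly (y k) t) ^+ 2 <= b k] by [].
apply: fin_bigcap_measurable => // k _; apply: measurable_le_set.
  exact/measurable_normc_sqr/cmeasurable_tap_poly.
exact: measurable_cst.
Qed.

(* The Newton divided difference at y_0, ..., y_i equals h_i plus a combination
   of the h_j with j > i, and is controlled by the first i + 1 values, hence by
   b_i when b is nondecreasing. *)
Lemma small_values_upper : exists2 K : R, 0 < K &
  forall b : nat -> R, (forall k, 0 < b k) ->
    (forall k i, (k <= i < s)%N -> b k <= b i) ->
    (P (small_values b) <= (K * \prod_(k < s) b k)%:E)%E.
Proof.
have [K0 K0_gt0 ub] := gaussian_box_ub P.
have dual i : exists beta : 'I_i.+1 -> R[i], (i < s)%N ->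
    forall j : 'I_i.+1, \sum_k beta k * y k ^+ j = (j == i :> nat)%:R.
  have [si|_] := boolP (i < s)%N; last by exists (fun=> 0).
  have yi k l : (k < i.+1)%N -> (l < i.+1)%N -> y k = y l -> k = l.
    by move=> ki li; apply: y_inj; exact: leq_trans si.
  by have [beta Hb] := vandermonde_dual yi (fun j => (j == i)%:R); exists beta.
have /all_sig[beta Hbeta] i := cid (dual i).
pose g i (j : nat) := \sum_k beta i k * y k ^+ j.
(* The opposite of the part of the i-th divided difference carried by later taps, so that h_i - f_i
   is the divided difference itself. *)
pose f (i : 'I_n) t := - \sum_(j < n | (i < j)%N) g i j * h j t.
pose M := 1 + \sum_(i < n) \sum_k normc (beta i k).
have M_ge (i : 'I_n) : \sum_k normc (beta i k) <= M.
  rewrite /M (bigD1 i) //= addrCA lerDl addr_ge0 // sumr_ge0 // => j _.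
  by rewrite sumr_ge0 // => k _; exact: normc_ge0.
have M0 : 0 < M.
  rewrite ltr_pwDl // sumr_ge0 // => j _.
  by rewrite sumr_ge0 // => k _; exact: normc_ge0.
(* Chosen so that K1 b_i = K0 (2 rho_i)^2 with rho_i = M sqrt(b_i), where M dominates the sums of
   the moduli of the weights. *)
pose K1 := K0 * (M *+ 2) ^+ 2.
have K1_gt0 : 0 < K1 by rewrite mulr_gt0 // exprn_gt0 // mulrn_wgt0.
exists (K1 ^+ s); first by rewrite exprn_gt0.
move=> b b0 bmono.
pose rho (i : 'I_n) := M * Num.sqrt (b i).
pose kappa (i : 'I_n) := K1 * b i.
have mf (i : 'I_n) : (i < s)%N ->
    cmeasurable (f i : g_sigma_algebraType (tail_rect h i.+1) -> R[i]).
  move=> _; have -> : f i = fun t => (- 1) * \sum_(j < n | (i < j)%N) g i j * h j t.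
    by apply/funext => t; rewrite mulN1r.
  apply: cmeasurableM; first exact: cmeasurable_cst.
  apply: cmeasurable_sum => j ij.
  by apply: cmeasurableM; [exact: cmeasurable_cst|exact: tail_cmeasurable].
have rho0 i : 0 < rho i by rewrite mulr_gt0 // sqrtr_gt0.
have kappa0 i : 0 <= kappa i by rewrite mulr_ge0 // ltW.
have sT : <<s tail_rect h s >> [set: T] by apply: sub_sigma_algebra; exact: tail_rect_setT.
have /(_ _)/le_trans := @chain_upper _ _ _ P n h mh indep s sn f rho kappa setT mf
  rho0 kappa0 sT.
have -> : K1 ^+ s * \prod_(k < s) b k = \prod_(j < n | (j < s)%N) kappa j.
  rewrite (big_ord_narrow (F := kappa) sn) /kappa big_split /=.
  by rewrite prodr_const card_ord.
rewrite probability_setT mule1 => H.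
apply: (@le_trans _ _ (P (chain h s f rho setT 0))); last first.
  apply: H => // i w si; apply: (le_trans (ub _ (gaussian_h i) _ _ _)).
    by rewrite mulrn_wge0 // ltW.
  rewrite lee_fin /kappa /K1 /rho -mulrnAl exprMn sqr_sqrtr; last exact: ltW.
  by rewrite mulrA.
apply: le_measure; rewrite ?inE.
- exact: measurable_small_values.
- have := @chain_sigma _ _ _ n h s sn f rho setT mf sT 0%N (leq0n s).
  exact: (tail_rect_sigma_measurable mh).
move=> t small; split=> // i /= si; apply: near_set_normc.
have -> : h i t - f i t = \sum_k beta i k * tap_poly (y k) t.
  transitivity (\sum_(j < n) g i j * h j t); last first.
    rewrite /g /tap_poly; under eq_bigr do rewrite mulr_suml.
    rewrite exchange_big /=; apply: eq_bigr => k _; rewrite mulr_sumr.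
    by apply: eq_bigr => j _; rewrite mulrAC mulrA.
  rewrite /f opprK [RHS](bigID (fun j : 'I_n => (i < j)%N)) /= addrC; congr (_ + _).
  rewrite (bigD1 i) ?ltnn //= big1 ?addr0.
    have := Hbeta i si ord_max; rewrite /= eqxx => gi.
    by rewrite /g gi mul1r.
  move=> j; rewrite -leqNgt -ltnS => /andP[ji nji].
  have := Hbeta i si (Ordinal ji); rewrite /= (_ : (j == i :> nat) = false) => [gj|].
    by rewrite /g gj mul0r.
  exact: negbTE.
apply: (le_trans (le_normc_sum _ _ _)).
apply: (@le_trans _ _ (\sum_k normc (beta i k) * Num.sqrt (b i))); last first.
  by rewrite -mulr_suml ler_wpM2r // sqrtr_ge0.
apply: ler_sum => k _; rewrite ComplexField.Normc.normcM ler_wpM2l ?normc_ge0 //.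
rewrite -(ger0_norm (normc_ge0 _)) -sqrtr_sqr ler_wsqrtr //.
have ki : (k <= i)%N by rewrite -ltnS.
apply: (le_trans (small k (leq_ltn_trans ki si))).
by rewrite bmono // ki.
Qed.

Hypothesis y1 : forall k, normc (y k) = 1.

(* Writing the columns j >= s of the Vandermonde matrix as combinations v of
   the first s ones, the values at y_0, ..., y_(s-1) depend only on the
   h_i + \sum_(j >= s) v_ij h_j with i < s. *)
Lemma small_values_lower : exists2 K : R, 0 < K &
  forall r : R, 0 < r <= 1 -> exists E : set T,
    [/\ measurable E, ((K * r ^+ 2 ^+ s)%:E <= P E)%E &
     forall t, E t ->
       (forall k, (k < s)%N -> normc (tap_poly (y k) t) <= (r *+ 2) *+ s) /\
       (s = n -> forall i, normc (h i t) <= r *+ 2)].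
Proof.
have interp (j : nat) : exists v : 'I_s -> R[i],
    forall k : 'I_s, \sum_i v i * y k ^+ i = y k ^+ j.
  exact: (vandermonde_interpolation y_inj (fun k => y k ^+ j)).
have /all_sig[v Hv] j := cid (interp j).
(* The entry v_ij, with default 0 for i >= s. *)
pose w (i j : nat) := if insub i is Some i' then v j i' else 0.
pose f (i : 'I_n) t := - \sum_(j < n | (s <= j)%N) w i j * h j t.
(* Confining the remaining taps to a fixed square has positive probability independent of r, and
   bounds all the centres f_i by [A]. *)
pose B : set T := [set t | forall j : 'I_n, (s <= j)%N -> near_set (h j) (fun=> 0) 1 t].
pose A := \sum_(i < n) \sum_(j < n | (s <= j)%N) normc (w i j) *+ 2.
have fA i t : B t -> normc (f i t) <= A.
  move=> Bt; rewrite /f normcN; apply: (le_trans (le_normc_sum _ _ _)).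
  apply: (@le_trans _ _ (\sum_(j < n | (s <= j)%N) normc (w i j) *+ 2)).
    apply: ler_sum => j sj; rewrite ComplexField.Normc.normcM -mulr_natr.
    rewrite ler_wpM2l ?normc_ge0 //.
    by have := normc_near_set (Bt j sj); rewrite subr0.
  rewrite /A [leRHS](bigD1 i) //= lerDl sumr_ge0 // => i' _.
  by rewrite sumr_ge0 // => j _; rewrite mulrn_wge0 // normc_ge0.
have A_ge0 : 0 <= A.
  by rewrite sumr_ge0 // => i _; rewrite sumr_ge0 // => j _; rewrite mulrn_wge0 // normc_ge0.
have [k k0 lb] := gaussian_box_lb P A.
have [k' k'0 lb'] := gaussian_box_lb P (0 : R).
have [sB PB] : <<s tail_rect h s >> B /\ (0 < P B)%E.
  pose D (j : 'I_n) : set (R * R) := if (s <= j)%N then box 0 1 else setT.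
  have mD j : measurable (D j) by rewrite /D; case: ifP => // _; exact: measurable_box.
  have BE : B = \bigcap_j ((ReIm \o h j) @^-1` D j).
    apply/seteqP; split=> t.
      by move=> Bt j _ /=; rewrite /D; case: ifP => // sj; exact: Bt.
    by move=> Dt j sj; have := Dt j I; rewrite /= /D sj.
  split.
    apply: sub_sigma_algebra; exists D; split=> // j js.
    by rewrite /D leqNgt js.
  rewrite BE tail_rect_prob //; elim/big_ind: _ => //.
    by move=> a b; exact: mule_gt0.
  move=> j _; rewrite /D; case: ifP => _; last by rewrite preimage_setT probability_setT.
  apply: (lt_le_trans _ (lb' _ (gaussian_h j) 0 1 _ _ _)); rewrite /= ?normr0 //.
    by rewrite lte_fin expr1n mulr1.
  by rewrite ltr01 lexx.
have [p p0 pB] : exists2 p : R, 0 < p & P B = p%:E.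
  have fB : P B \is a fin_num by rewrite fin_num_measure //; exact: (tail_rect_sigma_measurable mh sB).
  by exists (fine (P B)); rewrite ?fineK // -lte_fin fineK.
(* Each of the s taps contributes k (r / 2)^2, the half radius being that of the lower chain bound;
   p is the probability of [B]. *)
exists ((k / 4) ^+ s * p); first by rewrite mulr_gt0 // exprn_gt0 // divr_gt0.
move=> r r01; have /andP[r0 r1] := r01.
pose kappa (i : 'I_n) := k / 4 * r ^+ 2.
have kappa0 i : 0 <= kappa i by rewrite mulr_ge0 ?sqr_ge0 // divr_ge0 // ltW.
have mf (i : 'I_n) : (i < s)%N ->
    cmeasurable (f i : g_sigma_algebraType (tail_rect h i.+1) -> R[i]).
  move=> si; have -> : f i = fun t => (- 1) * \sum_(j < n | (s <= j)%N) w i j * h j t.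
    by apply/funext => t; rewrite mulN1r.
  apply: cmeasurableM; first exact: cmeasurable_cst.
  apply: cmeasurable_sum => j sj.
  apply: cmeasurableM; [exact: cmeasurable_cst|apply: tail_cmeasurable => //].
  exact: leq_trans sj.
exists (chain h s f (fun=> r) B 0); split.
- apply: (tail_rect_sigma_measurable mh (i := 0%N)).
  exact: (@chain_sigma _ _ _ n h s sn f (fun=> r) B mf sB 0%N (leq0n s)).
- have := @chain_lower _ _ _ P n h mh indep s sn f (fun=> r) kappa B mf
    (fun=> r0) kappa0 sB.
  rewrite pB -EFinM (big_ord_narrow (F := kappa) sn) /kappa prodr_const card_ord.
  have -> : (k / 4) ^+ s * p * r ^+ 2 ^+ s = (k / 4 * r ^+ 2) ^+ s * p.
    by rewrite [(k / 4 * _) ^+ s]exprMn mulrAC.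
  move=> lower; apply: lower => i t si Bt.
  have -> : k / 4 * r ^+ 2 = k * (r / 2) ^+ 2 by field.
  apply: lb => //.
  + exact: le_trans (le_Re_normc _) (fA i t Bt).
  + exact: le_trans (le_Im_normc _) (fA i t Bt).
  + by apply/andP; split; lra.
move=> t [Bt Ct]; split; last first.
  move=> sn' i; have := normc_near_set (Ct i _); rewrite /= sn' ltn_ord => /(_ isT).
  suff -> : f i t = 0 by rewrite subr0.
  by rewrite /f big1 ?oppr0 // => j; rewrite sn' leqNgt ltn_ord.
move=> l ls.
have -> : tap_poly (y l) t = \sum_(i < n | (i < s)%N) (h i t - f i t) * y l ^+ i.
  rewrite /tap_poly (bigID (fun i : 'I_n => (i < s)%N)) /=.
  under [RHS]eq_bigr do rewrite mulrBl; rewrite sumrB; congr (_ + _).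
  rewrite /f; under [in RHS]eq_bigr do rewrite mulNr mulr_suml.
  rewrite sumrN opprK exchange_big /=.
  rewrite (eq_bigl (fun j : 'I_n => (s <= j)%N)); last by move=> j; rewrite -leqNgt.
  apply: eq_bigr => j sj; rewrite -(Hv j (Ordinal ls)) mulr_sumr.
  rewrite [RHS](big_ord_narrow sn); apply: eq_bigr => i _ /=.
  by rewrite /w /= valK mulrCA mulrA.
apply: (le_trans (le_normc_sum _ _ _)).
apply: (@le_trans _ _ (\sum_(i < n | (i < s)%N) r *+ 2)).
  apply: ler_sum => i si; rewrite ComplexField.Normc.normcM normcX y1 expr1n mulr1.
  by apply: normc_near_set; apply: Ct.
by rewrite (big_ord_narrow (F := fun=> r *+ 2) sn) sumr_const card_ord.
Qed.

End SmallValues.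

(** * Sorted terms, exponents and nodes *)

Section SortedTerms.
Context {R : realFieldType}.

(** The order is recorded in a finite type, so that it can later index a union bound. *)
Lemma exists_sorting_tuple L (u : 'I_L -> R) (k0 : 'I_L) :
  exists t : L.-tuple 'I_L, uniq t /\
    forall i j, (i <= j < L)%N -> u (nth k0 t i) <= u (nth k0 t j).
Proof.
pose leu i j := u i <= u j.
have st : size (sort leu (enum 'I_L)) == L by rewrite size_sort size_enum_ord.
exists (Tuple st); split; first by rewrite /= sort_uniq enum_uniq.
move=> i j /andP[ij jL].
have leu_trans : transitive leu by move=> b a c; exact: le_trans.
have leu_refl : reflexive leu by move=> a; exact: lexx.
have leu_total : total leu by move=> a b; exact: le_total.
apply: (sorted_leq_nth leu_trans leu_refl k0 (sort_sorted leu_total _)) => //.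
- by rewrite inE (eqP st) (leq_ltn_trans ij).
- by rewrite inE (eqP st).
Qed.

Lemma sum_uniq_tuple L (t : L.-tuple 'I_L) (k0 : 'I_L) (F : 'I_L -> R) :
  uniq t -> \sum_i F i = \sum_(i < L) F (nth k0 t i).
Proof.
move=> ut; have nth_inj : injective (fun i : 'I_L => nth k0 t i).
  move=> i j /eqP; rewrite nth_uniq ?size_tuple ?ltn_ord //.
  by move=> /eqP; exact: val_inj.
by rewrite (reindex_inj nth_inj).
Qed.

Variables (L m : nat) (a : nat -> R) (c : R).
Hypothesis a_ge0 : forall i, 0 <= a i.
Hypothesis a_mono : forall i j, (i <= j < L)%N -> a i <= a j.
Hypothesis mL : (m < L)%N.
Hypothesis c_lt_sum : c < \sum_(i < L) (1 + a i)^-1.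

Let pos i : 0 < 1 + a i. Proof. by rewrite ltr_pwDl. Qed.

(** Every term is at most the first one. This serves the case m = 0, where the next lemma says
    nothing. *)
Lemma sum_inv_gt_first : 0 < c -> a 0 <= L%:R / c.
Proof.
move=> c0; rewrite ler_pdivlMr //.
have : \sum_(i < L) (1 + a i)^-1 <= L%:R / (1 + a 0).
  rewrite [leRHS](_ : _ = \sum_(i < L) (1 + a 0)^-1).
    by apply: ler_sum => i _; rewrite lef_pV2 ?posrE // lerD2l a_mono ?ltn_ord.
  by rewrite sumr_const card_ord mulr_natl.
move=> /(lt_le_trans c_lt_sum) /ltW; rewrite ler_pdivlMr //.
by rewrite mulrDr mulr1 mulrC; lra.
Qed.

(** Bound the terms before m by 1, except the i-th, and all others by 1 / (1 + a_m). Since the sum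
    exceeds m, the deficit a_i / (1 + a_i) of the i-th term is less than L / (1 + a_m). *)
Lemma sum_inv_gt i : m%:R <= c -> (i < m)%N ->
  a i <= 4 * L%:R ^+ 2 /\ a i * a m <= 4 * L%:R ^+ 2.
Proof.
move=> mc im.
have L1 : 1 <= L%:R :> R by rewrite ler1n; exact: leq_ltn_trans mL.
have iL : (i < L)%N := ltn_trans im mL.
have bound (l : 'I_L) : (1 + a l)^-1 <=
    (l < m)%N%:R - (l == Ordinal iL)%:R * (1 - (1 + a i)^-1) + (1 + a m)^-1.
  have inv_ge0 k : 0 <= (1 + a k)^-1 by rewrite invr_ge0 ltW.
  have [->|li] := eqVneq l (Ordinal iL).
    rewrite /= im -[true%:R]/(1 : R) mul1r.
    by have := inv_ge0 m; lra.
  rewrite mul0r subr0; have [lm|ml] := ltnP l m.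
    have : (1 + a l)^-1 <= 1 by rewrite invf_le1 // lerDl.
    by have := inv_ge0 m; rewrite -[true%:R]/(1 : R); lra.
  by rewrite add0r lef_pV2 ?posrE // lerD2l a_mono // ml ltn_ord.
have : m%:R < m%:R - (1 - (1 + a i)^-1) + L%:R * (1 + a m)^-1.
  apply: (le_lt_trans mc); apply: (lt_le_trans c_lt_sum).
  apply: (le_trans (ler_sum _ (fun l _ => bound l))); rewrite big_split sumrB /=.
  rewrite sumr_const card_ord -[_^-1 *+ L]mulr_natl lerD2r le_eqVlt; apply/orP; left; apply/eqP.
  congr (_ - _).
    rewrite -natr_sum; congr (_%:R).
    rewrite (eq_bigr (fun l : 'I_L => if (l < m)%N then 1%N else 0%N)) //.
    by rewrite -big_mkcond (big_ord_narrow (ltnW mL)) sum1_card card_ord.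
  rewrite -mulr_suml (bigD1 (Ordinal iL)) //= eqxx big1 ?addr0 ?mul1r //.
  by move=> l /negbTE ->.
set x := (1 + a i)^-1; set z := (1 + a m)^-1 => H.
have key : a i * (1 + a m) <= L%:R * (1 + a i).
  have xE : x * (1 + a i) = 1 by rewrite mulVf // gt_eqF.
  have zE : z * (1 + a m) = 1 by rewrite mulVf // gt_eqF.
  have : 0 <= (L%:R * z - (1 - x)) * ((1 + a i) * (1 + a m)).
    by rewrite mulr_ge0 ?mulr_ge0 ?ltW //; lra.
  have -> : (L%:R * z - (1 - x)) * ((1 + a i) * (1 + a m)) =
    L%:R * (1 + a i) * (z * (1 + a m)) - (1 + a m) * ((1 + a i) - x * (1 + a i)).
    by ring.
  by rewrite xE zE; nra.
have aim : a i <= a m by rewrite a_mono // (ltnW im).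
have ai0 := a_ge0 i; have am0 := a_ge0 m.
(* If a_m <= 2L, then a_i <= a_m gives a_i a_m <= 4L^2. Otherwise L a_i <= a_i a_m / 2 is absorbed
   on the left, leaving a_i a_m <= 2L. *)
have [amL|Lam] := leP (a m) (2 * L%:R); first by split; nra.
have : a i * a m <= 2 * L%:R by nra.
by split; nra.
Qed.

End SortedTerms.

Section Exponent.
Context {R : realType}.
Implicit Types f : R -> R.

Lemma log2_quotient (x y : R) : log2 x / log2 y = ln x / ln y.
Proof.
have l2 : ln 2 != 0 :> R by rewrite gt_eqF // ln_gt0 // ltr1n.
rewrite /log2; have [->|ly] := eqVneq (ln y) 0; first by rewrite mul0r !invr0 !mulr0.
by field; rewrite ly l2.
Qed.

(** The upper bound loses a factor q = x^(1/(N+1)), which shifts the exponent by 1/(N+1); as N is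
    arbitrary, the limit is unaffected even though K depends on N. Stating it in q confines real
    powers to this proof. *)
Lemma log_quotient_cvg f (D : nat) :
  (exists2 k : R, 0 < k & forall x, 1 <= x -> k / x ^+ D <= f x) ->
  (forall N : nat, exists2 K : R, 0 < K &
    forall q, 1 <= q -> f (q ^+ N.+1) <= K * q / q ^+ N.+1 ^+ D) ->
  log2 (f x) / log2 x @[x --> +oo] --> (- D%:R : R).
Proof.
move=> [k k0 lb] ub.
apply/cvgrPdist_lt => e e0.
pose N := Num.truncn (2 / e).
have Ne : N.+1%:R^-1 < e / 2.
  have /andP[_ H] := truncn_itv (ltW (divr_gt0 (ltr0Sn R 1) e0)).
  by rewrite -[ltRHS]invf_div ltf_pV2 ?posrE ?divr_gt0 // ltr0n.
have [K K0 ubK] := ub N.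
pose B := `|ln k| + `|ln K|.
(* Beyond this threshold the constants k and K contribute less than (e / 2) ln x; the choice of N
   leaves the other half of e to the lost factor. *)
have nxB : \forall x \near (+oo : set_system R), expR (2 * B / e) < x.
  by apply: nbhs_pinfty_gt; exact: num_real.
have nx1 : \forall x \near (+oo : set_system R), 1 < x.
  by apply: nbhs_pinfty_gt; exact: num_real.
near=> x.
have x1 : 1 < x by near: x.
have xB : expR (2 * B / e) < x by near: x.
have x0 : 0 < x by exact: lt_trans x1.
have lx0 : 0 < ln x by exact: ln_gt0.
have lxB : 2 * B / e < ln x by rewrite -ltr_expR lnK.
have fx0 : 0 < f x.
  by apply: lt_le_trans (lb x (ltW x1)); rewrite divr_gt0 // exprn_gt0.
have lnD : ln (x ^+ D) = D%:R * ln x by rewrite lnXn // mulr_natl.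
have lower : ln k - D%:R * ln x <= ln (f x).
  rewrite -lnD -ln_div ?posrE ?exprn_gt0 // ler_ln ?posrE ?divr_gt0 ?exprn_gt0 //.
  exact/lb/ltW.
pose q := x `^ N.+1%:R^-1.
have q0 : 0 < q by exact: powR_gt0.
have qx : q ^+ N.+1 = x.
  by rewrite /q -powR_mulrn ?powR_ge0 // -powRrM mulVf ?powRr1 ?ltW // pnatr_eq0.
have q1 : 1 <= q.
  by rewrite -ler_ln ?posrE // ln1 ln_powR mulr_ge0 ?invr_ge0 ?ler0n // ltW.
have upper : ln (f x) <= ln K + N.+1%:R^-1 * ln x - D%:R * ln x.
  rewrite -lnD -ln_powR -/q -lnM ?posrE // -ln_div ?posrE ?exprn_gt0 ?mulr_gt0 //.
  rewrite ler_ln ?posrE ?divr_gt0 ?exprn_gt0 ?mulr_gt0 //.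
  by have := ubK q q1; rewrite qx.
have lk : - B <= ln k.
  by rewrite /B; have := lerNnormlW (lexx `|ln k|); have := normr_ge0 (ln K); lra.
have lK : ln K <= B.
  by rewrite /B; have := ler_norm (ln K); have := normr_ge0 (ln k); lra.
have eB : B < e / 2 * ln x.
  by move: lxB; rewrite ltr_pdivrMr //; lra.
move: Ne lower upper; rewrite log2_quotient.
move: (N.+1%:R^-1) (D%:R : R) => iN Dr Ne lower upper.
have -> : - Dr - ln (f x) / ln x = - (ln (f x) + Dr * ln x) / ln x.
  by field; rewrite gt_eqF.
have iNe : iN * ln x < e / 2 * ln x by rewrite ltr_pM2r.
have : 0 < e / 2 * ln x by rewrite mulr_gt0 // divr_gt0.
rewrite mulNr normrN ltr_norml ltr_pdivrMr // ltr_pdivlMr // => elx.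
by apply/andP; split; lra.
Unshelve. all: by end_near. Qed.

Lemma log_powR_cvg (D : R) :
  log2 (x `^ D) / log2 x @[x --> +oo] --> D.
Proof.
apply/cvgrPdist_lt => e e0.
have nx1 : \forall x \near (+oo : set_system R), 1 < x.
  by apply: nbhs_pinfty_gt; exact: num_real.
near=> x.
have x1 : 1 < x by near: x.
by rewrite log2_quotient ln_powR mulfK ?subrr ?normr0 // gt_eqF // ln_gt0.
Unshelve. all: by end_near. Qed.

End Exponent.

Section Nodes.
Context {R : realType}.

Definition node (L k : nat) : R[i] := expi (- (2 * pi * k%:R / L%:R)).

(** Equal nodes give an angle difference of cosine 1, that is 1 - 2 sin^2 of its half; but for i < j
    < L the half difference lies strictly between 0 and pi, where the sine is positive. *)
Lemma node_inj L i j : (i < L)%N -> (j < L)%N -> node L i = node L j -> i = j.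
Proof.
wlog ij : i j / (i < j)%N.
  move=> H iL jL e; have [ij|ji|//] := ltngtP i j; first exact: H e.
  by apply/esym; apply: H ji jL iL (esym e).
move=> iL jL [ec es]; exfalso; move: ec es.
rewrite !cosN !sinN => ec /oppr_inj es.
have L0 : 0 < L%:R :> R by rewrite ltr0n (leq_ltn_trans _ jL).
set b := 2 * pi * j%:R / L%:R in ec es; set a := 2 * pi * i%:R / L%:R in ec es.
have cos1 : cos (b - a) = 1 by rewrite cosB ec es -!expr2 cos2Dsin2.
have half0 : 0 < (b - a) / 2 < pi.
  have -> : (b - a) / 2 = pi * ((j - i)%:R / L%:R).
    by rewrite natrB ?(ltnW ij) // /a /b; field; rewrite gt_eqF.
  rewrite mulr_gt0 ?pi_gt0 ?divr_gt0 ?L0 ?ltr0n ?subn_gt0 //=.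
  rewrite gtr_pMr ?pi_gt0 // ltr_pdivrMr // mul1r ltr_nat.
  by rewrite (leq_ltn_trans (leq_subr _ _)).
have := sin_gt0_pi half0; have : cos (((b - a) / 2) *+ 2) = 1.
  by rewrite -mulr_natr divfK.
rewrite cos_mulr2n cos2sin2 -mulr_natr => H s0.
have : 0 < sin ((b - a) / 2) ^+ 2 by rewrite exprn_gt0.
by lra.
Qed.

End Nodes.

(** * The outage event *)

Section OutageEvent.
Context {d : measure_display} {T : measurableType d} {R : realType}.
Variables (P : probability T R) (nu L : nat) (h : 'I_nu.+1 -> T -> R[i]).
Hypothesis nuL : (nu < L)%N.
Hypothesis gaussian_h : forall i, standard_complex_gaussian P (h i).
Hypothesis indep : mutually_independent P h.
Local Notation normc := ComplexField.Normc.normc.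

Let L0 : 0 < L%:R :> R. Proof. by rewrite ltr0n (leq_ltn_trans _ nuL). Qed.

Let mh i : cmeasurable (h i).
Proof. by apply/cmeasurableE; have [] := gaussian_h i. Qed.

Lemma node_exp k i : node L k ^+ i = expi (- (2 * pi * i%:R * k%:R / L%:R)) :> R[i].
Proof.
rewrite /node; elim: i => [|i IH].
  by rewrite expr0 mulr0 !mul0r oppr0 /expi cos0 sin0.
have iS : i.+1%:R = i%:R + 1 :> R by rewrite natr1.
rewrite exprS IH iS /expi; set u := 2 * pi * k%:R / L%:R.
have -> : 2 * pi * (i%:R + 1) * k%:R / L%:R = u + 2 * pi * i%:R * k%:R / L%:R.
  by rewrite /u; field; rewrite gt_eqF.
rewrite opprD cosD sinD; apply/eqP; rewrite eq_complex /=.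
by apply/andP; split; apply/eqP; ring.
Qed.

Lemma channel_eigenvalueE t (k : 'I_L) :
  channel_eigenvalue (h ^~ t) k = tap_poly h (node L k) t.
Proof. by apply: eq_bigr => i _; rewrite node_exp. Qed.

(** This is L / (1 + SINR), so outage means that it exceeds 2^(-rate) L. *)
Definition inv_sinr_sum (snr : R) (t : T) : R :=
  \sum_(k < L) (1 + snr * normc (tap_poly h (node L k) t) ^+ 2)^-1.

Lemma mutual_information_lt (rate snr : R) (k : 'I_L) t : 0 < snr ->
  (mutual_information snr (circulant_channel L (h ^~ t)) k < rate) =
  (2 `^ (- rate) * L%:R < inv_sinr_sum snr t).
Proof.
move=> snr0; rewrite /mutual_information mmse_sinrE // addrC subrK.
under eq_bigr do rewrite channel_eigenvalueE.
rewrite -/(inv_sinr_sum snr t).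
have S0 : 0 < inv_sinr_sum snr t.
  rewrite /inv_sinr_sum (bigD1 k) //= ltr_pwDl ?sumr_ge0 // => [|i _].
    by rewrite invr_gt0 ltr_pwDl // mulr_ge0 ?sqr_ge0 // ltW.
  by rewrite invr_ge0 addr_ge0 // mulr_ge0 ?sqr_ge0 // ltW.
have l2 : 0 < ln 2 :> R by rewrite ln_gt0 // ltr1n.
have LS : 0 < L%:R^-1 * inv_sinr_sum snr t by rewrite mulr_gt0 // invr_gt0.
rewrite /log2 ltr_pdivrMr // lnV ?posrE // ltrNl -mulNr -ln_powR.
by rewrite ltr_ln ?posrE ?powR_gt0 // [L%:R^-1 * _]mulrC ltr_pdivlMr.
Qed.

Lemma measurable_inv_sinr_sum (c snr : R) : 0 < snr ->
  measurable [set t | c < inv_sinr_sum snr t].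
Proof.
move=> snr0; have mS : measurable_fun setT (inv_sinr_sum snr).
  have -> : inv_sinr_sum snr = (fun t => \sum_(k < L)
      expR (- ln (1 + snr * normc (tap_poly h (node L k) t) ^+ 2))).
    apply/funext => t; apply: eq_bigr => k _.
    by rewrite expRN lnK // posrE ltr_pwDl // mulr_ge0 ?sqr_ge0 // ltW.
  apply: measurable_sum => k.
  apply: measurableT_comp; first exact: measurable_expR.
  apply: measurable_funN.
  apply: measurableT_comp; first exact: measurable_ln.
  apply: measurable_funD => //.
  apply: measurable_funM => //.
  by apply: measurable_normc_sqr; exact: cmeasurable_tap_poly gaussian_h _.
have -> : [set t | c < inv_sinr_sum snr t] = ~` [set t | inv_sinr_sum snr t <= c].
  by apply/seteqP; split=> t /=; rewrite ltNge => /negP.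
by apply: measurableC; apply: measurable_le_set.
Qed.

Lemma probability_union_bound (I : finType) (E : set T) (A : I -> set T) :
  measurable E -> (forall i, measurable (A i)) ->
  (forall t, E t -> exists i, A i t) -> (P E <= \sum_i P (A i))%E.
Proof.
move=> mE mA cover.
have mU (s : seq I) : measurable (\big[setU/set0]_(i <- s) A i).
  by apply: bigsetU_measurable.
apply: (@le_trans _ _ (P (\big[setU/set0]_i A i))).
  apply: le_measure; rewrite ?inE // => t /cover[i Ait].
  by rewrite (bigD1 i) //=; left.
elim: (index_enum I) => [|i s IH]; first by rewrite !big_nil measure0.
rewrite !big_cons; apply: (le_trans (measureU2 _ (mA i) (mU s))).
by rewrite leeD2l.
Qed.

Variable c : R.
Hypothesis c0 : 0 < c.

(* Sort the 1 + u_k with u_k = snr |lambda_k|^2.  The m smallest u_i satisfy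
   u_i <= C and u_i u_m <= C; the range of u_m is split at the powers q^j of
   q = snr^(1/(N+1)), so that u_i <= C / q^j and u_m <= C q^(j+1) on the j-th
   piece, while u_i <= C / snr when u_m > snr. *)
Lemma outage_upper (m : nat) : (m <= nu)%N -> m%:R <= c ->
  forall N : nat, exists2 K : R, 0 < K & forall q, 1 <= q ->
    fine (P [set t | c < inv_sinr_sum (q ^+ N.+1) t]) <=
      K * q / q ^+ N.+1 ^+ m.+1.
Proof.
move=> mnu mc N.
have mL : (m < L)%N by exact: leq_ltn_trans nuL.
pose k0 : 'I_L := Ordinal mL.
pose C : R := 4 * L%:R ^+ 2 + L%:R / c.
have C1 : 4 * L%:R ^+ 2 <= C by rewrite /C lerDl divr_ge0 // ltW.
have C2 : L%:R / c <= C by rewrite /C lerDr mulr_ge0 // sqr_ge0.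
have C0 : 0 < C by apply: lt_le_trans C2; rewrite divr_gt0.
pose y (t : L.-tuple 'I_L) i := node L (nth k0 t i) : R[i].
(* On the last piece, u_m > snr and only the m smallest values are controlled. *)
pose s (j : nat) := if (j < N.+1)%N then m.+1 else m.
pose b (j : nat) (q : R) (i : nat) :=
  if (j < N.+1)%N then
    if (i < m)%N then C / (q ^+ N.+1 * q ^+ j) else C * q ^+ j.+1 / q ^+ N.+1
  else C / (q ^+ N.+1) ^+ 2.
(* Without repetition the selected nodes are distinct. For m = 0 only piece 0 is kept: there u_0 is
   bounded outright, and the bounds of the other pieces would be too weak. *)
pose ok (p : L.-tuple 'I_L * 'I_N.+2) := uniq p.1 && ((p.2 == 0 :> nat) || (0 < m)%N).
pose A q (p : L.-tuple 'I_L * 'I_N.+2) :=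
  if ok p then small_values h (s p.2) (y p.1) (b p.2 q) else set0.
have mA q p : measurable (A q p).
  by rewrite /A; case: ifP => // _; exact: measurable_small_values gaussian_h _ _ _.
have Aub p : exists2 K : R, 0 < K &
    forall q, 1 <= q -> (P (A q p) <= (K * (q / q ^+ N.+1 ^+ m.+1))%:E)%E.
  rewrite /A; case: (boolP (ok p)) => okp; last first.
    exists 1 => // q q1; have q0 := lt_le_trans ltr01 q1.
    by rewrite measure0 lee_fin mul1r divr_ge0 ?exprn_ge0 // ltW.
  have /andP[up jm] := okp.
  have sn : (s p.2 <= nu.+1)%N by rewrite /s; case: ifP => _; rewrite ?ltnS // ltnW.
  have y_inj i j : (i < s p.2)%N -> (j < s p.2)%N -> y p.1 i = y p.1 j -> i = j.
    move=> is_ js; have iL := leq_trans is_ (leq_trans sn nuL).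
    have jL := leq_trans js (leq_trans sn nuL).
    move/(node_inj (ltn_ord _) (ltn_ord _))/val_inj/eqP.
    by rewrite nth_uniq ?size_tuple // => /eqP.
  have [K K_gt0 HK] := small_values_upper gaussian_h indep sn y_inj.
  exists (K * C ^+ s p.2); first by rewrite mulr_gt0 // exprn_gt0.
  move=> q q1; have q0 := lt_le_trans ltr01 q1.
  set x := q ^+ N.+1; have x0 : 0 < x by rewrite exprn_gt0.
  have x1 : 1 <= x by rewrite exprn_ege1.
  have b0 i : 0 < b p.2 q i.
    rewrite /b; case: ifP => _; last by rewrite divr_gt0 // !exprn_gt0.
    by case: ifP => _; rewrite divr_gt0 ?mulr_gt0 ?exprn_gt0.
  have bmono i j : (i <= j < s p.2)%N -> b p.2 q i <= b p.2 q j.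
    move=> /andP[ij js]; rewrite /b; case: ifP => // _.
    case: ifPn => im; case: ifPn => jm'; rewrite ?lexx //; last first.
      by move: im; rewrite (leq_ltn_trans ij).
    rewrite -/x [leRHS]mulrAC invfM mulrA ler_pM2l ?divr_gt0 //.
    by apply: (@le_trans _ _ 1); rewrite ?invf_le1 ?exprn_gt0 ?exprn_ege1.
  apply: (le_trans (HK _ b0 bmono)); rewrite lee_fin -mulrA ler_pM2l //.
  move: jm; rewrite /b /s -/x; case: ifP => jN jm.
    rewrite big_ord_recr /= ltnn (eq_bigr (fun=> C / (x * q ^+ p.2))); last first.
      by move=> i _; rewrite ltn_ord.
    rewrite prodr_const card_ord.
    (* The gain q^(-jm) from the m smallest values pays for the loss q^j in the bound on u_m, as m
       >= 1 or j = 0; one factor q remains. *)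
    have -> : (C / (x * q ^+ p.2)) ^+ m * (C * q ^+ p.2.+1 / x) =
        C ^+ m.+1 * ((q / x ^+ m.+1) * (q ^+ p.2 / q ^+ p.2 ^+ m)).
      rewrite !exprMn !exprVn !exprMn !exprS; field.
      by rewrite !gt_eqF ?exprn_gt0.
    have A0 : 0 <= q / x ^+ m.+1 by rewrite divr_ge0 ?exprn_ge0 // ltW.
    rewrite ler_pM2l ?exprn_gt0 // ler_piMr //.
    rewrite ler_pdivrMr ?exprn_gt0 // mul1r.
    case/orP: jm => [/eqP ->|m0]; first by rewrite !expr0 expr1n.
    by rewrite -{1}[q ^+ p.2]expr1 ler_weXn2l // exprn_ege1.
  (* Last piece: m values, each at most C / x^2, give x^(-2m) <= x^(-(m+1)) because m >= 1. *)
  rewrite prodr_const card_ord exprMn ler_pM2l ?exprn_gt0 // exprVn.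
  have m0 : (0 < m)%N.
    by case/orP: jm => // /eqP j0; move: jN; rewrite j0.
  rewrite ler_pdivlMr ?exprn_gt0 // mulrC ler_pdivrMr ?exprn_gt0 //.
  rewrite -(exprM x 2 m) -[leLHS]mul1r ler_pM ?exprn_ge0 ?(ltW x0) ?(ltW q0) //.
  by rewrite ler_weXn2l // mul2n -addnn -addn1 leq_add2l.
have /all_sig2[K K_gt0 HK] p := cid2 (Aub p).
exists (1 + \sum_p K p).
  by rewrite ltr_pwDl // sumr_ge0 // => p _; exact: ltW.
move=> q q1; have q0 := lt_le_trans ltr01 q1.
set x := q ^+ N.+1; have x0 : 0 < x by rewrite exprn_gt0.
have mE := measurable_inv_sinr_sum c x0.
have qx0 : 0 <= q / x ^+ m.+1 by rewrite divr_ge0 ?exprn_ge0 // ltW.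
pose E := [set t | c < inv_sinr_sum x t].
suff : (P E <= ((\sum_p K p) * (q / x ^+ m.+1))%:E)%E.
  move=> H; rewrite -lee_fin fineK ?fin_num_measure // (le_trans H) // lee_fin.
  by rewrite -mulrA ler_wpM2r // lerDr.
apply: (@le_trans _ _ (\sum_p P (A q p))%E); last first.
  rewrite mulr_suml -sumEFin; apply: lee_sum => p _.
  exact: HK.
apply: probability_union_bound => // t /= ct.
pose u (k : 'I_L) := x * normc (tap_poly h (node L k) t) ^+ 2.
have u0 k : 0 <= u k by rewrite mulr_ge0 ?sqr_ge0 // ltW.
have [sg [usg sg_mono]] := exists_sorting_tuple u k0.
pose a i := u (nth k0 sg i).
have a0 i : 0 <= a i by exact: u0.
have small i B : a i <= B -> normc (tap_poly h (y sg i) t) ^+ 2 <= B / x.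
  by rewrite ler_pdivlMr // mulrC.
have ca : c < \sum_(i < L) (1 + a i)^-1.
  by rewrite /a -(sum_uniq_tuple k0 (fun k => (1 + u k)^-1) usg).
have [m0|m0] := posnP m.
  exists (sg, ord0); rewrite /A /ok usg /= /s /b /= => i.
  rewrite m0 ltnS leqn0 ltn0 => /eqP ->; apply: small.
  have := sum_inv_gt_first a0 sg_mono ca c0 => /le_trans; apply.
  by apply: (le_trans C2); rewrite expr1 ler_peMr // ltW.
have aC i : (i < m)%N -> a i <= C /\ a i * a m <= C.
  move=> im; have [H1 H2] := sum_inv_gt a0 sg_mono mL ca mc im.
  by split; apply: le_trans C1.
(* Taking the least admissible j also yields a_m > q^j when j > 0, the lower bound that turns a_i
   a_m <= C into a_i <= C / q^j. *)
have [[j /andP[jN amj] jmin]|none] :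
    (exists2 j, (j < N.+1)%N && (a m <= q ^+ j.+1) &
       forall i, (i < j)%N -> q ^+ i.+1 < a m) \/
    (forall j, (j < N.+1)%N -> q ^+ j.+1 < a m).
  have [ex|nex] := pselect (exists j, (j < N.+1)%N && (a m <= q ^+ j.+1)).
    left; case: (ex_minnP ex) => j Hj jmin; exists j => // i ij.
    rewrite ltNge; apply/negP => ami; have := jmin i; rewrite [(j <= i)%N]leqNgt ij.
    by case/andP: Hj => jN _; rewrite (ltn_trans ij jN) ami => /(_ isT).
  by right=> j jN; rewrite ltNge; apply/negP => amj; apply: nex; exists j; rewrite jN.
- have jN2 : (j < N.+2)%N by exact: ltnW.
  exists (sg, Ordinal jN2); rewrite /A /ok usg m0 orbT /= /s /b /= jN => i.
  rewrite ltnS leq_eqVlt => /orP[/eqP ->|im].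
    rewrite ltnn; apply: small; apply: (le_trans amj).
    rewrite ler_peMl ?exprn_ge0 ?(ltW q0) //; apply: le_trans C1.
    have : 1 <= L%:R :> R by rewrite ler1n (leq_ltn_trans _ mL).
    by move=> L1; nra.
  rewrite im -/x invfM mulrCA mulrC; apply: small.
  have [H1 H2] := aC i im.
  rewrite ler_pdivlMr ?exprn_gt0 //; case: j jmin {jN amj jN2} => [|j] jmin.
    by rewrite expr0 mulr1.
  by apply: le_trans H2; rewrite ler_wpM2l // ltW // jmin.
exists (sg, ord_max); rewrite /A /ok usg m0 orbT /= /s /b /= ltnn => i im.
rewrite -/x expr2 invfM mulrA; apply: small.
have [_ H2] := aC i im; rewrite ler_pdivlMr //; apply: le_trans H2.
by rewrite ler_wpM2l // ltW // none.
Qed.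

(** [s] is the exponent paid and [S] the number of eigenvalues forced to be small. Normally S <= s;
    but once s = nu + 1, all taps are small and every eigenvalue is small at no further cost. *)
Lemma outage_lower (s S : nat) : (s <= nu.+1)%N -> (S <= L)%N -> c < S%:R ->
  (S <= s)%N || (s == nu.+1) ->
  exists2 K : R, 0 < K & forall snr, 1 <= snr ->
    K / snr ^+ s <= fine (P [set t | c < inv_sinr_sum snr t]).
Proof.
move=> sn SL cS Ss.
have node_injs i j : (i < s)%N -> (j < s)%N -> node L i = node L j :> R[i] -> i = j.
  by move=> is_ js; apply: node_inj; exact: leq_trans (leq_trans _ sn) nuL.
have [K K0 HK] := small_values_lower gaussian_h indep sn node_injs
  (fun k => normc_expi _).
(* So S = c (1 + e): S terms of the form 1 / (1 + v) with v < e already exceed c. *)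
pose e := (S%:R - c) / c.
have e0 : 0 < e by rewrite divr_gt0 // subr_gt0.
pose M : R := 4 * nu.+1%:R ^+ 2.
have M1 : 1 <= M.
  have : 1 <= nu.+1%:R :> R by rewrite ler1n.
  by rewrite /M => ?; nra.
have M0 : 0 < M by exact: lt_le_trans M1.
(* With r = delta / sqrt(snr), the values are at most 2 (nu + 1) r, so snr times their squares is at
   most M delta^2; this choice makes it less than e and keeps delta <= 1. *)
pose delta := e / (M * (1 + e)).
have e10 : 0 < 1 + e by rewrite addr_gt0.
have delta0 : 0 < delta by rewrite divr_gt0 // mulr_gt0.
have delta1 : delta <= 1.
  by rewrite ler_pdivrMr ?mulr_gt0 // mul1r; nra.
have Mdelta : M * delta ^+ 2 < e.
  have H : M * delta = e / (1 + e).
    by rewrite /delta; field; rewrite !gt_eqF.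
  apply: (@le_lt_trans _ _ (M * delta)).
    by rewrite ler_pM2l // expr2 ler_piMl // ltW.
  by rewrite H ltr_pdivrMr //; nra.
exists (K * delta ^+ 2 ^+ s); first by rewrite mulr_gt0 // !exprn_gt0.
move=> snr snr1; have snr0 := lt_le_trans ltr01 snr1.
have sq1 : 1 <= Num.sqrt snr by rewrite -sqrtr1 ler_wsqrtr.
have sq0 : 0 < Num.sqrt snr by exact: lt_le_trans sq1.
pose r := delta / Num.sqrt snr.
have r2 : r ^+ 2 = delta ^+ 2 / snr by rewrite expr_div_n sqr_sqrtr // ltW.
have r01 : 0 < r <= 1.
  by rewrite divr_gt0 //= ler_pdivrMr // mul1r (le_trans delta1).
have [E [mE PE Esmall]] := HK r r01.
have mO := measurable_inv_sinr_sum c snr0.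
rewrite -mulrA -exprVn -exprMn -r2 -lee_fin fineK ?fin_num_measure //.
apply: (le_trans PE); apply: le_measure; rewrite ?inE // => t Et /=.
have [small1 small2] := Esmall t Et.
have small (k : 'I_L) : (k < S)%N ->
    normc (tap_poly h (node L k) t) <= (r *+ 2) *+ nu.+1.
  have r2n : 0 <= r *+ 2 by rewrite mulrn_wge0 //; case/andP: r01 => /ltW.
  move=> kS; have [ks|] := boolP (k < s)%N.
    by apply: (le_trans (small1 k ks)); rewrite ler_wpMn2l.
  rewrite -leqNgt => sk; case/orP: Ss => [Ss|/eqP snu].
    by move: (leq_trans kS (leq_trans Ss sk)); rewrite ltnn.
  apply: (le_trans (le_normc_sum _ _ _)).
  apply: (@le_trans _ _ (\sum_(i < nu.+1) r *+ 2)); last first.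
    by rewrite sumr_const card_ord.
  apply: ler_sum => i _; rewrite ComplexField.Normc.normcM normcX normc_expi.
  by rewrite expr1n mulr1; exact: small2.
have Md0 : 0 < 1 + M * delta ^+ 2 by rewrite ltr_pwDl // mulr_ge0 ?sqr_ge0 // ltW.
apply: (@lt_le_trans _ _ (\sum_(k < L | (k < S)%N) (1 + M * delta ^+ 2)^-1)).
  rewrite (big_ord_narrow (F := fun=> (1 + M * delta ^+ 2)^-1) SL) sumr_const card_ord.
  rewrite -mulr_natl ltr_pdivlMr //.
  have -> : S%:R = c * (1 + e) by rewrite /e; field; rewrite gt_eqF.
  by rewrite ltr_pM2l // ltrD2l.
have pos (k : 'I_L) : 0 < 1 + snr * normc (tap_poly h (node L k) t) ^+ 2.
  by rewrite ltr_pwDl // mulr_ge0 ?sqr_ge0 // ltW.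
rewrite /inv_sinr_sum [leRHS](bigID (fun k : 'I_L => (k < S)%N)) /= ler_wpDr //.
  by apply: sumr_ge0 => k _; rewrite invr_ge0 ltW.
apply: ler_sum => k kS; rewrite lef_pV2 ?posrE // lerD2l.
have -> : M * delta ^+ 2 = snr * ((r *+ 2) *+ nu.+1) ^+ 2.
  rewrite -(mulr_natr (r *+ 2)) -(mulr_natr r 2) [(_ * nu.+1%:R) ^+ 2]exprMn [(r * _) ^+ 2]exprMn r2 /M; field.
  by rewrite gt_eqF.
by rewrite ler_pM2l // lerXn2r ?nnegrE ?normc_ge0 ?small // (le_trans (normc_ge0 _) (small k kS)).
Qed.

End OutageEvent.

(** * The exponent in the two regimes of the rate *)

Theorem corollary1 (d : measure_display) (T : measurableType d) (R : realType)
    (P : probability T R) (nu L : nat) (rate : R)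
    (h : 'I_nu.+1 -> T -> R[i]) (k : 'I_L) :
  (1 <= nu)%N -> (nu + 1 <= L)%N -> 0 < rate ->
  (forall i, standard_complex_gaussian P (h i)) ->
  mutually_independent P h ->
  exp_equal (outage_probability P h rate k)
            (fun snr => snr `^ (- outage_exponent P h rate k)) /\
  outage_exponent P h rate k =
    if rate <= log2 (L%:R / nu%:R) then nu%:R + 1
    else (Num.floor (2 `^ (- rate) * L%:R))%:~R + 1.
Proof.
move=> nu1; rewrite addn1 => nuL rate0 gaussian_h indep.
have L0 : 0 < L%:R :> R by rewrite ltr0n (leq_ltn_trans _ nuL).
have l2 : 0 < ln 2 :> R by rewrite ln_gt0 // ltr1n.
pose c : R := 2 `^ (- rate) * L%:R.
have c0 : 0 < c by rewrite mulr_gt0 // powR_gt0.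
(* A positive rate leaves room for outage: L terms close to 1 exceed c. The case m = nu relies on
   this, as c may then be larger than nu + 1. *)
have cL : c < L%:R.
  by rewrite gtr_pMl // -ltr_ln ?posrE ?powR_gt0 // ln_powR ln1 mulNr oppr_lt0 mulr_gt0.
have rateE : (rate <= log2 (L%:R / nu%:R)) = (nu%:R <= c).
  have nu0 : 0 < nu%:R :> R by rewrite ltr0n.
  rewrite /log2 ler_pdivlMr // -ln_powR ler_ln ?posrE ?powR_gt0 ?divr_gt0 //.
  by rewrite ler_pdivlMr // /c powRN ler_pdivlMl ?powR_gt0.
(* Both regimes take the single form m + 1, with m = nu when nu <= c and m the integer part of c
   otherwise. *)
have [m [mnu mc cm ->]] : exists m : nat,
    [/\ (m <= nu)%N, m%:R <= c, (m == nu) || (c < m.+1%:R) &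
      (if rate <= log2 (L%:R / nu%:R) then nu%:R + 1
       else (Num.floor (2 `^ (- rate) * L%:R))%:~R + 1) = m.+1%:R :> R].
  rewrite rateE -/c; case: ifPn => [nuc|]; first by exists nu; rewrite eqxx natr1.
  rewrite -ltNge => cnu; have /andP[c1 c2] := truncn_itv (ltW c0).
  exists (Num.truncn c); split=> //.
  - by rewrite ltnW // -(ltr_nat R) (le_lt_trans c1).
  - by rewrite c2 orbT.
  - rewrite -natr1; congr (_ + _).
    have -> : Num.floor c = Num.truncn c :> int.
      by apply: Num.Theory.floor_def; rewrite -natz !natz intrD natr1 c1 c2.
    by [].
have outE snr : 0 < snr -> outage_probability P h rate k snr =
    fine (P [set t | c < inv_sinr_sum L h snr t]).
  move=> snr0; rewrite /outage_probability; congr (fine (P _)).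
  by apply/seteqP; split=> t /=; rewrite mutual_information_lt.
have cvg : log2 (outage_probability P h rate k snr) / log2 snr @[snr --> +oo]
    --> (- m.+1%:R : R).
  apply: log_quotient_cvg => [|N].
    pose S := if m == nu then L else m.+1.
    have [||||K K0 HK] := @outage_lower _ _ _ P nu L h nuL gaussian_h indep c c0 m.+1 S.
    - by [].
    - by rewrite /S; case: ifP => // _; exact: leq_ltn_trans nuL.
    - by move: cm; rewrite /S; case: ifP.
    - by rewrite /S; case: ifP => [/eqP ->|_]; rewrite ?eqxx ?orbT ?leqnn.
    exists K => // snr snr1; rewrite outE; first exact: HK.
    exact: lt_le_trans snr1.
  have [K K0 HK] := outage_upper nuL gaussian_h indep c0 mnu mc N.
  exists K => // q q1; rewrite outE; first exact: HK.
  by rewrite exprn_gt0 // (lt_le_trans ltr01).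
have expE : outage_exponent P h rate k = m.+1%:R.
  by rewrite /outage_exponent (cvg_lim _ cvg) ?opprK //; exact: norm_hausdorff.
split=> //; exists (- m.+1%:R); split=> //.
by rewrite expE; exact: log_powR_cvg.
Qed.
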